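(* In the endomorphism monoid $\mathcal{E}_4=\mathrm{End}(\mathcal{T}_4)$, the following statements hold: (1) $\alpha\mathrel{\mathscr{L}}\beta$ if and only if $\alpha=\beta$ or $\alpha,\beta\in\mathcal{G}_4$ or $\alpha=\sigma^g$, $\beta=\sigma^h$ both lie in $D(4)$ with $4g=4h$; (2) $\alpha\mathrel{\mathscr{R}}\beta$ if and only if $\alpha,\beta\in E_k(4)$ for some $1\le k\le3$ or $\alpha,\beta\in\mathcal{G}_4$ or $\alpha,\beta\in D(4)$ or $\alpha\mathcal{G}_4=\beta\mathcal{G}_4$; (3) $\alpha\mathrel{\widetilde{\mathscr{L}}}\beta$ if and only if $\alpha=\beta$ or $\alpha,\beta\in\mathcal{G}_4\cup B(4)\cup C(4)$ or $\alpha=\sigma^g$, $\beta=\sigma^h$ both lie in $D(4)$ with $4g=4h$; (4) $\alpha\mathrel{\mathscr{L}^*}\beta$ if and only if $\alpha,\beta\in\mathcal{G}_4$ or $\alpha^2=\alpha=\beta=\beta^2$ or $\alpha=\sigma^g$, $\beta=\sigma^h$ both lie in $D(4)$ with $4g=4h$ or $\alpha=\phi_{t,e}$, $\beta=\phi_{u,f}$ both lie in $B(4)\cup C(4)$ with $\mathrm{Fix}(t,e)=\mathrm{Fix}(u,f)$; (5) $\mathscr{D}^*=\mathscr{J}^*$ and the $\mathscr{D}^*$-classes are $\mathcal{G}_4$, $D(4)$, $E_3(4)\cup B(4)\cup E_2(4)\cup C(4)$ and $E_1(4)$; (6) the $\widetilde{\mathscr{D}}$-classes are $D(4)$, $E_1(4)$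 and $\mathcal{E}_4\setminus(D(4)\cup E_1(4))$; (7) the $\widetilde{\mathscr{J}}$-classes are $\mathcal{E}_4\setminus E_1(4)$ and $E_1(4)$.
   Context: Maps are written on the right and composed left to right. For $n=4$: $\mathcal{T}_n$ is the full transformation semigroup of all maps $\{1,\dots,n\}\to\{1,\dots,n\}$; $\mathcal{S}_n$, $\mathcal{A}_n$ are the symmetric and alternating groups, $\mathrm{id}$ the identity map, $c_i$ the constant map with image $i$, and $s^g=g^{-1}sg$ for $g\in\mathcal{S}_n$, $s\in\mathcal{T}_n$. $\mathcal{E}_n=\mathrm{End}(\mathcal{T}_n)$ is the monoid of all semigroup endomorphisms of $\mathcal{T}_n$ (not required to fix $\mathrm{id}$), and $\mathcal{G}_n=\mathrm{Aut}(\mathcal{T}_n)$. For $g\in\mathcal{S}_n$, $\psi_g:s\mapsto s^g$. For $t,e\in\mathcal{T}_n$, $\phi_{t,e}$ sends $s\mapsto t$ if $s\in\mathcal{S}_n\setminus\mathcal{A}_n$, $s\mapsto t^2$ if $s\in\mathcal{A}_n$, $s\mapsto e$ if $s\in\mathcal{T}_n\setminus\mathcal{S}_n$. Let $\mathcal{K}=\{\mathrm{id},(1\,2)(3\,4),(1\,3)(2\,4),(1\,4)(2\,3)\}$, and for $s\in\mathcal{S}_4$ let $p_s$ be the unique element of the coset $\mathcal{K}s$ fixing $4$. Let $\sigma:\mathcal{T}_4\to\mathcal{T}_4$ be given by $s\sigma=p_s$ if $s\in\mathcal{S}_4$ and $s\sigma=c_4$ if $s\in\mathcal{T}_4\setminus\mathcal{S}_4$;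 for $g\in\mathcal{S}_4$ let $\sigma^g$ be the map $s\mapsto(s\sigma)^g=g^{-1}(s\sigma)g$. Put $D(4)=\{\sigma^g:g\in\mathcal{S}_4\}$. By a known theorem of Schein and Teclezghi, $\mathcal{G}_4=\{\psi_g:g\in\mathcal{S}_4\}$ and $\mathcal{E}_4=\mathcal{G}_4\cup\{\phi_{t,e}: t,e\in\mathcal{T}_4,\ t^3=t,\ te=et=e^2=e\}\cup D(4)$. Define, for $n=4$ (in each case $\phi_{t,e}$ is assumed to lie in $\mathcal{E}_n$): $E_3(n)=\{\phi_{t,e}: t\in\mathcal{S}_n\setminus\mathcal{A}_n,\ e\ne\mathrm{id}\}$; $B(n)=\{\phi_{t,e}: t\in\mathcal{T}_n\setminus\mathcal{S}_n,\ t\ne t^2,\ t^2\neq e,\ e\ne\mathrm{id}\}$; $E_2(n)=\{\phi_{\mathrm{id},e}: e\ne\mathrm{id}\}$; $C(n)=\{\phi_{t,e}: t\in\mathcal{T}_n\setminus\mathcal{S}_n,\ t=t^2,\ t\neq e,\ e\neq\mathrm{id}\}$; $E_1(n)=\{\phi_{e,e}\}$. $\mathrm{Fix}(t,e)=\{g\in\mathcal{S}_n: t^g=t\text{ and }e^g=e\}$. Relations on $\mathcal{E}_n$: $\alpha\mathrel{\mathscr{L}}\beta$ iff $\mathcal{E}_n\alpha=\mathcal{E}_n\beta$; $\alpha\mathrel{\mathscr{R}}\beta$ iff $\alpha\mathcal{E}_n=\beta\mathcal{E}_n$; $\alpha\mathrel{\mathscr{R}^*}\beta$ iff for all $\gamma,\delta\in\mathcal{E}_n$,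 $\gamma\alpha=\delta\alpha\Leftrightarrow\gamma\beta=\delta\beta$; $\alpha\mathrel{\mathscr{L}^*}\beta$ iff for all $\gamma,\delta\in\mathcal{E}_n$, $\alpha\gamma=\alpha\delta\Leftrightarrow\beta\gamma=\beta\delta$; $\alpha\mathrel{\widetilde{\mathscr{R}}}\beta$ iff for all idempotents $\eta\in\mathcal{E}_n$, $\eta\alpha=\alpha\Leftrightarrow\eta\beta=\beta$; $\alpha\mathrel{\widetilde{\mathscr{L}}}\beta$ iff for all idempotents $\eta\in\mathcal{E}_n$, $\alpha\eta=\alpha\Leftrightarrow\beta\eta=\beta$; $\mathscr{D}^*=\mathscr{L}^*\vee\mathscr{R}^*$ and $\widetilde{\mathscr{D}}=\widetilde{\mathscr{L}}\vee\widetilde{\mathscr{R}}$ (joins of equivalence relations); $\alpha\mathrel{\mathscr{J}^*}\beta$ iff $J^*(\alpha)=J^*(\beta)$ and $\alpha\mathrel{\widetilde{\mathscr{J}}}\beta$ iff $\widetilde{J}(\alpha)=\widetilde{J}(\beta)$, where $J^*(\alpha)$ [resp. $\widetilde{J}(\alpha)$] is the smallest ideal containing $\alpha$ that is a union of $\mathscr{L}^*$-classes and a union of $\mathscr{R}^*$-classes [resp. of $\widetilde{\mathscr{L}}$-classes and of $\widetilde{\mathscr{R}}$-classes]. *)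

(* Defs.v *)
From HB Require Import structures.
From Stdlib Require Import Relation_Operators.
From mathcomp Require Import all_boot all_fingroup.
From mathcomp Require Import alt.

Set Implicit Arguments.
Unset Strict Implicit.
Unset Printing Implicit Defensive.

Local Open Scope group_scope.

Section Relations.
Variable M : monoidType.
Implicit Types (a b c d x : M) (I : M -> Prop).

Definition idem x := x * x = x.

Definition greenL a b :=
  forall x, (exists c, x = c * a) <-> (exists c, x = c * b).
Definition greenR a b :=
  forall x, (exists c, x = a * c) <-> (exists c, x = b * c).

Definition starL a b := forall c d, a * c = a * d <-> b * c = b * d.
Definition starR a b := forall c d, c * a = d * a <-> c * b = d * b.

Definition tildeL a b := forall x, idem x -> (a * x = a <-> b * x = b).
Definition tildeR a b := forall x, idem x -> (x * a = a <-> x * b = b).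

(* The least equivalence relation containing r1 and r2. *)
Definition rel_join (r1 r2 : M -> M -> Prop) : M -> M -> Prop :=
  clos_refl_sym_trans M (fun a b => r1 a b \/ r2 a b).

Definition starD := rel_join starL starR.
Definition tildeD := rel_join tildeL tildeR.

Definition ideal I := forall a c, I a -> I (c * a) /\ I (a * c).

(* For an equivalence relation r: I is a union of r-classes. *)
Definition saturated (r : M -> M -> Prop) I := forall a b, r a b -> I a -> I b.

(* Membership of x in the least ideal that contains a and is a union of
   r1-classes and a union of r2-classes. *)
Definition sat_ideal (r1 r2 : M -> M -> Prop) a x :=
  forall I, ideal I -> saturated r1 I -> saturated r2 I -> I a -> I x.

Definition starJ a b :=
  forall x, sat_ideal starL starR a x <-> sat_ideal starL starR b x.
Definition tildeJ a b :=
  forall x, sat_ideal tildeL tildeR a x <-> sat_ideal tildeL tildeR b x.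

End Relations.

(* P is the set of all classes of the equivalence relation r. *)
Definition classes_are (T : finType) (r : T -> T -> Prop) (P : {set {set T}}) :=
  forall X : {set T}, X \in P <-> exists a, forall b, b \in X <-> r a b.

(* The full transformation monoid on 'I_n; as for {perm 'I_n}, s * t is s
   followed by t.  A new type is needed because {ffun 'I_n -> 'I_n} already
   carries a pointwise product. *)
Record trans n := Trans { trans_fun :> {ffun 'I_n -> 'I_n} }.
HB.instance Definition _ n := [isNew for @trans_fun n].
HB.instance Definition _ n := [Finite of trans n by <:].

Section TransMonoid.
Variable n : nat.
Implicit Types s t u : trans n.

Definition trans_one : trans n := Trans [ffun i => i].
Definition trans_mul s t : trans n := Trans [ffun i => t (s i)].

Lemma trans_mulA : associative trans_mul.
Proof. by move=> s t u; apply/val_inj/ffunP=> i; rewrite /= !ffunE. Qed.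
Lemma trans_mul1 : left_id trans_one trans_mul.
Proof. by move=> s; apply/val_inj/ffunP=> i; rewrite /= !ffunE. Qed.
Lemma trans_1mul : right_id trans_one trans_mul.
Proof. by move=> s; apply/val_inj/ffunP=> i; rewrite /= !ffunE. Qed.

HB.instance Definition _ :=
  isMonoid.Build (trans n) trans_mulA trans_mul1 trans_1mul.

End TransMonoid.

(* Semigroup endomorphisms of trans n, not required to fix 1; composition is
   again left to right. *)
Record tend n := Tend {
  tend_fun :> {ffun trans n -> trans n};
  _ : [forall s : trans n, forall t : trans n,
         tend_fun (s * t) == tend_fun s * tend_fun t] }.
HB.instance Definition _ n := [isSub for @tend_fun n].
HB.instance Definition _ n := [Finite of tend n by <:].

Section EndMonoid.
Variable n : nat.
Implicit Types a b : tend n.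

Lemma tendM a s t : a (s * t) = a s * a t.
Proof. by case: a => f /= /forallP/(_ s)/forallP/(_ t)/eqP. Qed.

Fact tend_one_proof : let f := [ffun s : trans n => s] in
  [forall s : trans n, forall t : trans n, f (s * t) == f s * f t].
Proof. by apply/forallP=> s; apply/forallP=> t; rewrite !ffunE. Qed.
Definition tend_one : tend n := Tend tend_one_proof.

Fact tend_mul_proof a b : let f := [ffun s : trans n => b (a s)] in
  [forall s : trans n, forall t : trans n, f (s * t) == f s * f t].
Proof. by apply/forallP=> s; apply/forallP=> t; rewrite !ffunE !tendM. Qed.
Definition tend_mul a b : tend n := Tend (tend_mul_proof a b).

Lemma tend_mulA : associative tend_mul.
Proof. by move=> a b c; apply/val_inj/ffunP=> s; rewrite /= !ffunE. Qed.
Lemma tend_mul1 : left_id tend_one tend_mul.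
Proof. by move=> a; apply/val_inj/ffunP=> s; rewrite /= !ffunE. Qed.
Lemma tend_1mul : right_id tend_one tend_mul.
Proof. by move=> a; apply/val_inj/ffunP=> s; rewrite /= !ffunE. Qed.

HB.instance Definition _ :=
  isMonoid.Build (tend n) tend_mulA tend_mul1 tend_1mul.

End EndMonoid.

Section Families.
Variable n : nat.
Implicit Types (g : 'S_n) (s t e : trans n).

Definition trans_of_perm g : trans n := Trans (val g).
Definition Sym_tr : {set trans n} := [set trans_of_perm g | g : 'S_n].
Definition Alt_tr : {set trans n} :=
  [set trans_of_perm g | g in 'Alt_('I_n)].

Definition tconj s g : trans n := trans_of_perm g^-1 * s * trans_of_perm g.

Definition phi t e : {ffun trans n -> trans n} :=
  [ffun s => if s \in Sym_tr :\: Alt_tr then t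
             else if s \in Alt_tr then t ^+ 2 else e].

Definition Fix_pair t e : {set 'S_n} :=
  [set g | (tconj t g == t) && (tconj e g == e)].

Definition AutT : {set tend n} :=
  [set a : tend n | injectiveb a && [forall t, exists s, a s == t]].

Definition phi_family (P : trans n -> trans n -> bool) : {set tend n} :=
  [set a | [exists t, exists e, (tend_fun a == phi t e) && P t e]].

Definition E3 := phi_family (fun t e => (t \in Sym_tr :\: Alt_tr) && (e != 1)).
Definition Bn := phi_family (fun t e =>
  [&& t \notin Sym_tr, t != t ^+ 2, t ^+ 2 != e & e != 1]).
Definition E2 := phi_family (fun t e => (t == 1) && (e != 1)).
Definition Cn := phi_family (fun t e =>
  [&& t \notin Sym_tr, t == t ^+ 2, t != e & e != 1]).
Definition E1 := phi_family (fun t e => t == e).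

End Families.

(* The points are numbered from 1; pt4 is the point called 4. *)
Definition pt1 : 'I_4 := @Ordinal 4 0 isT.
Definition pt2 : 'I_4 := @Ordinal 4 1 isT.
Definition pt3 : 'I_4 := @Ordinal 4 2 isT.
Definition pt4 : 'I_4 := @Ordinal 4 3 isT.

Definition Klein : {set 'S_4} :=
  [set 1; tperm pt1 pt2 * tperm pt3 pt4; tperm pt1 pt3 * tperm pt2 pt4;
          tperm pt1 pt4 * tperm pt2 pt3].

(* The element of the coset Klein :* s fixing pt4; it exists and is unique by
   p_permP, so the default value of odflt is never used. *)
Definition p_perm (s : 'S_4) : 'S_4 :=
  odflt s [pick p in Klein :* s | p pt4 == pt4].

Lemma Klein_regular i : exists2 k, k \in Klein &
  forall k', k' \in Klein -> (k' pt4 == i) = (k' == k).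
Proof.
have HK : {in Klein &, injective (fun k : 'S_4 => k pt4)}.
  move=> k k'; rewrite !inE -!orbA.
  by do 2![case/or4P=> /eqP->]; rewrite ?permM ?perm1 //;
     do !rewrite permE /=.
suff [k kK ki] : exists2 k, k \in Klein & k pt4 = i.
  exists k => // k' k'K; apply/eqP/eqP=> [|->//].
  by rewrite -ki; apply: HK.
case: i => [[|[|[|[|//]]]]] lti.
- exists (tperm pt1 pt4 * tperm pt2 pt3); first by rewrite !inE eqxx !orbT.
  by apply: val_inj; rewrite permM; do !rewrite permE /=.
- exists (tperm pt1 pt3 * tperm pt2 pt4); first by rewrite !inE eqxx !orbT.
  by apply: val_inj; rewrite permM; do !rewrite permE /=.
- exists (tperm pt1 pt2 * tperm pt3 pt4); first by rewrite !inE eqxx !orbT.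
  by apply: val_inj; rewrite permM; do !rewrite permE /=.
- exists 1; first by rewrite !inE eqxx.
  by apply: val_inj; rewrite perm1.
Qed.

Lemma p_permP s p : (p \in Klein :* s) && (p pt4 == pt4) = (p == p_perm s).
Proof.
have [k kK kP] := Klein_regular (s^-1 pt4).
have uq q : (q \in Klein :* s) && (q pt4 == pt4) = (q == k * s).
  rewrite mem_rcoset; apply/andP/eqP=> [[qK /eqP q4]|->].
    have := kP _ qK; rewrite permM q4 eqxx => /esym/eqP <-.
    by rewrite mulgKV.
  by rewrite mulgK permM; have := kP k kK; rewrite eqxx => /eqP->; rewrite permKV.
rewrite uq /p_perm; case: pickP => [q|/(_ (k * s))] /=; rewrite uq ?eqxx //.
by move/eqP->.
Qed.

Definition sigma (s : trans 4) : trans 4 :=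
  if [pick g : 'S_4 | trans_of_perm g == s] is Some g
  then trans_of_perm (p_perm g) else Trans [ffun => pt4].

Definition sigma_conj (g : 'S_4) : {ffun trans 4 -> trans 4} :=
  [ffun s => tconj (sigma s) g].

Definition D4 : {set tend 4} :=
  [set a | [exists g, tend_fun a == sigma_conj g]].

Definition sigma_agree (a b : tend 4) :=
  exists g h : 'S_4, [/\ tend_fun a = sigma_conj g, tend_fun b = sigma_conj h
                       & g pt4 = h pt4].

Definition BC_fix_agree (n : nat) (a b : tend n) :=
  exists t e u f : trans n,
    [/\ tend_fun a = phi t e, tend_fun b = phi u f,
        a \in Bn n :|: Cn n, b \in Bn n :|: Cn n & Fix_pair t e = Fix_pair u f].

Definition AutT_orbit_eq (n : nat) (a b : tend n) :=
  [set a * c | c in AutT n] = [set b * c | c in AutT n].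

(* Main.v *)
From HB Require Import structures.
From Stdlib Require Import Relation_Operators.
Require Import Defs.
From mathcomp Require Import all_boot all_fingroup.
From mathcomp Require Import alt.

Set Implicit Arguments.
Unset Strict Implicit.
Unset Printing Implicit Defensive.

Local Open Scope group_scope.

(** Everything follows from the list of the endomorphisms of the monoid of maps
    of four points ([tend4_cases]) and from their products. The list is found by
    testing an endomorphism [a] on the constant maps. If it separates two of them it separates all, is injective, and is
    the conjugation by the permutation that it induces on the constant maps.
    Otherwise all of them have one image [d], which absorbs every value of [a],
    so that all values of [a] fix a point. A 4-cycle then acts through at most
    three points and its square is lost: the kernel of [a] on the permutations
    contains the Klein group. This suffices to collapse all singular maps onto
    [d], and leaves a morphism from the quotient of 'S_4 by the Klein group,
    that is, from the stabiliser of the point 4. If the 3-cycles are lost too,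
    only the parity of a permutation counts and [a = phi t e]; if not, [a] acts
    on the four points as the stabiliser does, and [a] is a conjugate of
    [sigma].

    The products are simple. Right multiplication by [a] applies [a] to the pair
    [(t, e)] ([phi_end_mul]), and left multiplication acts on [phi t e] through
    the parity of permutations only ([left_multipleP]). The conjugates of
    [sigma] multiply through the projection [p_perm] of 'S_4 onto the stabiliser
    of 4 ([psi_mul_sig], [sig_mul_sig]).

    Five kernels occur, numbered by [rank_class]. Equal kernels give R*-related
    endomorphisms ([starR_rank]); conversely the sets [k < rank_class a] are
    those of the elements with a given idempotent left identity
    ([left_identities]), so R* and R~ both coincide with equality of
    [rank_class]. On the other side, the elements of E1, E2 and E3 are
    idempotent, so there L, L* and L~ agree; an element [sigma^g] has a right
    identity that remembers only the image of 4 under [g]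
    ([sig_right_identity]); and for B and C the product with anything but an
    automorphism falls into E1 ([BC_mul_nonAut]), which leaves 1 as the only
    idempotent right identity and the stabiliser of the pair as the only
    information on cancellation ([BC_cancel]). The joins and the saturated
    ideals follow from these descriptions, with [rank_class] monotone under
    products ([rank_mul]) and one pair of L*-related elements of B and C
    ([link_starL]) joining their R*-classes. *)

(** * Transformations *)

Section Transformations.
Variable n : nat.
Implicit Types (s t u : trans n) (g h : 'S_n) (i j k : 'I_n).

Definition cst i : trans n := Trans [ffun => i].

Lemma trans_ext s t : s =1 t -> s = t.
Proof. by move=> eq_st; apply/val_inj/ffunP. Qed.

Lemma transM s t i : (s * t) i = t (s i).
Proof. by rewrite ffunE. Qed.

Lemma trans1 i : (1 : trans n) i = i.
Proof. by rewrite ffunE. Qed.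

Lemma cstE i j : cst i j = i.
Proof. by rewrite ffunE. Qed.

Lemma trans_of_permE g i : trans_of_perm g i = g i.
Proof. by rewrite pvalE. Qed.

Lemma mul_cst s i : s * cst i = cst i.
Proof. by apply: trans_ext => j; rewrite transM !cstE. Qed.

Lemma cst_mul i s : cst i * s = cst (s i).
Proof. by apply: trans_ext => j; rewrite transM !cstE. Qed.

Lemma trans_of_perm1 : trans_of_perm (1 : 'S_n) = 1.
Proof. by apply: trans_ext => i; rewrite trans_of_permE perm1 trans1. Qed.

Lemma trans_of_permM : {morph @trans_of_perm n : g h / g * h}.
Proof.
by move=> g h; apply: trans_ext => i; rewrite transM !trans_of_permE permM.
Qed.

Lemma trans_of_perm_inj : injective (@trans_of_perm n).
Proof.
by move=> g h eq_gh; apply/permP=> i; rewrite -!trans_of_permE eq_gh.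
Qed.

Lemma mem_Sym_tr g : trans_of_perm g \in Sym_tr n.
Proof. exact: imset_f. Qed.

Lemma mem_Alt_tr g : (trans_of_perm g \in Alt_tr n) = ~~ g.
Proof. by rewrite mem_imset ?Alt_even //; exact: trans_of_perm_inj. Qed.

Lemma Sym_trP s : reflect (injective s) (s \in Sym_tr n).
Proof.
apply: (iffP imsetP) => [[g _ ->] i j | inj_s].
  by rewrite !trans_of_permE => /perm_inj.
exists (perm inj_s) => //.
by apply: trans_ext => i; rewrite trans_of_permE permE.
Qed.

Lemma Sym_trM s t : (s * t \in Sym_tr n) = (s \in Sym_tr n) && (t \in Sym_tr n).
Proof.
apply/idP/andP=> [/Sym_trP inj_st|[/imsetP[g _ ->] /imsetP[h _ ->]]]; last first.
  by rewrite -trans_of_permM mem_Sym_tr.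
have inj_s : injective s by move=> i j eq_s; apply: inj_st; rewrite !transM eq_s.
have [s' sK s'K] := injF_bij inj_s.
split; apply/Sym_trP => // i j eq_t.
by rewrite -[i]s'K -[j]s'K; congr (s _); apply: inj_st; rewrite !transM !s'K.
Qed.

(** The missed point matters because every map that moves nothing but this
    point fixes [s] on the right. *)
Lemma singular_misses s : s \notin Sym_tr n -> exists k, forall i, s i != k.
Proof.
move=> sing_s.
suff /existsP[k /forallP k_out] : [exists k, forall i, s i != k] by exists k.
apply: contraNT sing_s => /existsPn surj_s.
suff /image_injP inj_s : #|image s 'I_n| == #|'I_n|.
  by apply/Sym_trP=> i j; apply: inj_s.
apply/eqP/eq_card => k.
have /forallPn[i /negPn/eqP <-] := surj_s k.
by rewrite image_f.
Qed.

Lemma cst_inj : injective cst.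
Proof. by move=> i j eq_c; rewrite -(cstE i i) eq_c cstE. Qed.

Lemma tconjE s g : trans_of_perm g * tconj s g = s * trans_of_perm g.
Proof. by rewrite /tconj !mulgA -trans_of_permM mulgV trans_of_perm1 mul1g. Qed.

Lemma tconj_uniq s t g :
  (trans_of_perm g * t = s * trans_of_perm g) -> t = tconj s g.
Proof.
move=> eq_gt; rewrite /tconj -mulgA -eq_gt mulgA -trans_of_permM mulVg.
by rewrite trans_of_perm1 mul1g.
Qed.

Lemma tconjP s t g : reflect (forall i, t (g i) = g (s i)) (t == tconj s g).
Proof.
apply: (iffP eqP) => [-> i | eq_t].
  by rewrite -!trans_of_permE -!transM tconjE.
by apply: tconj_uniq; apply: trans_ext => i; rewrite !transM !trans_of_permE.
Qed.

Lemma tconjM s t g : tconj (s * t) g = tconj s g * tconj t g.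
Proof.
by rewrite /tconj !mulgA -[_ * _ * trans_of_perm _^-1]mulgA -trans_of_permM mulgV
           trans_of_perm1 mulg1.
Qed.

Lemma tconj_perm g h : tconj (trans_of_perm g) h = trans_of_perm (g ^ h).
Proof. by rewrite /tconj -!trans_of_permM conjgE mulgA. Qed.

Lemma tconj_cst i g : tconj (cst i) g = cst (g i).
Proof. by rewrite /tconj mul_cst cst_mul trans_of_permE. Qed.

Lemma tconj1 s : tconj s 1 = s.
Proof. by rewrite /tconj invg1 trans_of_perm1 mul1g mulg1. Qed.

Lemma tconj_comp s g h : tconj (tconj s g) h = tconj s (g * h).
Proof. by rewrite /tconj invMg !trans_of_permM !mulgA. Qed.

Lemma tconj_inj g : injective ((@tconj n)^~ g).
Proof.
move=> s t /(congr1 (fun u : trans n => tconj u g^-1)).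
by rewrite !tconj_comp mulgV !tconj1.
Qed.

Lemma Sym_tr_conj s g : (tconj s g \in Sym_tr n) = (s \in Sym_tr n).
Proof. by rewrite /tconj !Sym_trM !mem_Sym_tr andbT. Qed.

End Transformations.

(** * The three families of endomorphisms *)

(** A total constructor: a map that is not multiplicative is sent to 1, so
    that families of endomorphisms can be indexed without carrying proofs. *)
Definition mk_end n (F : {ffun trans n -> trans n}) : tend n :=
  insubd (tend_one n) F.

Lemma mk_endE n (F : {ffun trans n -> trans n}) :
  (forall s t, F (s * t) = F s * F t) -> tend_fun (mk_end F) = F.
Proof.
move=> FM; apply: insubdK.
by apply/forallP=> s; apply/forallP=> t; apply/eqP.
Qed.

(* Locked, like [phi_end] and [sig]: unification would otherwise unfold and
   compare the maps themselves. *)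
HB.lock Definition psi n (g : 'S_n) : tend n := mk_end [ffun s => tconj s g].
Arguments psi {n} g.

HB.lock Definition phi_end n (t e : trans n) : tend n := mk_end (phi t e).
Arguments phi_end {n} t e.

Section Endomorphisms.
Variable n : nat.
Implicit Types (s t u e f : trans n) (g h : 'S_n) (a b : tend n).

Lemma tend_ext a b : a =1 b -> a = b.
Proof. by move=> eq_ab; apply/val_inj/ffunP. Qed.

Lemma tend_mulE a b s : (a * b) s = b (a s).
Proof. by rewrite ffunE. Qed.

Lemma tend1E s : (1 : tend n) s = s.
Proof. by rewrite ffunE. Qed.

Lemma psiE g s : psi g s = tconj s g.
Proof. by rewrite psi.unlock mk_endE ?ffunE // => u v; rewrite !ffunE tconjM. Qed.

Lemma psiM g h : psi g * psi h = psi (g * h).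
Proof. by apply: tend_ext => s; rewrite tend_mulE !psiE tconj_comp. Qed.

Lemma psi1 : psi 1 = 1 :> tend n.
Proof. by apply: tend_ext => s; rewrite psiE tend1E tconj1. Qed.

Lemma psi_Aut g : psi g \in AutT n.
Proof.
rewrite inE; apply/andP; split.
  by apply/injectiveP=> s t; rewrite !psiE => /tconj_inj.
apply/forallP=> t; apply/existsP; exists (tconj t g^-1).
by rewrite psiE tconj_comp mulVg tconj1.
Qed.

Lemma AutT_inj a : a \in AutT n -> injective a.
Proof. by rewrite inE => /andP[/injectiveP]. Qed.

Lemma inj_AutT a : injective a -> a \in AutT n.
Proof.
move=> inj_a; rewrite inE; apply/andP; split; first exact/injectiveP.
have [a' aK a'K] := injF_bij inj_a.
by apply/forallP=> t; apply/existsP; exists (a' t); rewrite a'K.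
Qed.

Lemma AutT_mul a b : (a * b \in AutT n) = (a \in AutT n) && (b \in AutT n).
Proof.
apply/idP/andP=> [/AutT_inj inj_ab | [/AutT_inj inj_a /AutT_inj inj_b]]; last first.
  by apply: inj_AutT => s t; rewrite !tend_mulE => /inj_b/inj_a.
have inj_a : injective a.
  by move=> s t eq_a; apply: inj_ab; rewrite !tend_mulE eq_a.
have [a' aK a'K] := injF_bij inj_a.
split; apply: inj_AutT => // s t eq_b.
by rewrite -[s]a'K -[t]a'K; congr (a _); apply: inj_ab; rewrite !tend_mulE !a'K.
Qed.

(** The conditions under which [phi t e] is an endomorphism. *)
Definition phi_ok t e := [&& t * t * t == t, t * e == e, e * t == e & e * e == e].

Lemma phi_perm t e g : phi t e (trans_of_perm g) = if g : bool then t else t * t.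
Proof.
by rewrite ffunE inE mem_Alt_tr mem_Sym_tr negbK andbT; case: (odd_perm g).
Qed.

Lemma phi_sing t e s : s \notin Sym_tr n -> phi t e s = e.
Proof.
move=> sing_s; rewrite ffunE inE (negPf sing_s) andbF.
case: ifP => // /imsetP[g _ s_g].
by rewrite s_g mem_Sym_tr in sing_s.
Qed.

Lemma phi1 t e : phi t e 1 = t * t.
Proof. by rewrite -trans_of_perm1 phi_perm odd_perm1. Qed.

Lemma perm_or_sing s : (exists g, s = trans_of_perm g) \/ s \notin Sym_tr n.
Proof.
by case: (boolP (s \in Sym_tr n)) => [/imsetP[g _ ->]|]; [left; exists g | right].
Qed.

Lemma phi_endE t e : phi_ok t e -> tend_fun (phi_end t e) = phi t e.
Proof.
case/and4P=> /eqP ttt /eqP te /eqP et /eqP ee; rewrite phi_end.unlock.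
apply: mk_endE => s s'.
have [[g ->]|sing_s] := perm_or_sing s; last first.
  rewrite [LHS]phi_sing ?Sym_trM ?(negPf sing_s) // (phi_sing t e sing_s).
  have [[h ->]|sing_s'] := perm_or_sing s'; last by rewrite phi_sing.
  by rewrite phi_perm; case: (h : bool); rewrite ?mulgA !et.
have [[h ->]|sing_s'] := perm_or_sing s'; last first.
  rewrite [LHS]phi_sing ?Sym_trM ?(negPf sing_s') ?andbF // (phi_sing t e sing_s').
  by rewrite phi_perm; case: (g : bool); rewrite -?mulgA !te.
rewrite -trans_of_permM !phi_perm odd_permM.
by case: (odd_perm g); case: (odd_perm h); rewrite //= ?mulgA ttt.
Qed.

(** A right factor acts on the pair; this rule gives all the products whose left
    factor is of the form [phi_end t e]. *)
Lemma phi_end_mul t e a :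
  phi_ok t e -> phi_ok (a t) (a e) /\ phi_end t e * a = phi_end (a t) (a e).
Proof.
move=> ok_te; have := ok_te => /and4P[/eqP ttt /eqP te /eqP et /eqP ee].
have ok_a : phi_ok (a t) (a e).
  by rewrite /phi_ok -!tendM ttt te et ee !eqxx.
split=> //; apply: tend_ext => s; rewrite tend_mulE !phi_endE //.
have [[g ->]|sing_s] := perm_or_sing s; last by rewrite !phi_sing.
by rewrite !phi_perm; case: (g : bool); rewrite ?tendM.
Qed.

(** Left multiplication by [a] acts on [phi t e] only through the way in which
    [a] permutes or merges its three blocks of constancy: the odd permutations,
    the even permutations and the singular maps. *)
Lemma mul_phi_end t e a (ok_te : phi_ok t e) s :
  (a * phi_end t e) s = phi t e (a s).
Proof. by rewrite tend_mulE phi_endE. Qed.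

Lemma psi_mul_phi g t e : phi_ok t e -> psi g * phi_end t e = phi_end t e.
Proof.
move=> ok_te; apply: tend_ext => s; rewrite mul_phi_end // psiE phi_endE //.
have [[h ->]|sing_s] := perm_or_sing s; last by rewrite !phi_sing ?Sym_tr_conj.
by rewrite tconj_perm !phi_perm odd_permJ.
Qed.

End Endomorphisms.

(** * The Klein group and the projection of 'S_4 onto a point stabiliser *)

Lemma ord4P (i : 'I_4) : [\/ i = pt1, i = pt2, i = pt3 | i = pt4].
Proof.
case: i => [[|[|[|[|//]]]] lti];
  [constructor 1 | constructor 2 | constructor 3 | constructor 4]; exact: val_inj.
Qed.

Definition tr4 (i j k l : 'I_4) : trans 4 :=
  Trans [ffun m : 'I_4 => nth i [:: i; j; k; l] m].

Lemma tr4E i j k l :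
  (tr4 i j k l pt1 = i) * (tr4 i j k l pt2 = j) *
  (tr4 i j k l pt3 = k) * (tr4 i j k l pt4 = l).
Proof. by do !split; rewrite /tr4 ffunE. Qed.

Lemma trans4_ext (s t : trans 4) :
  s pt1 = t pt1 -> s pt2 = t pt2 -> s pt3 = t pt3 -> s pt4 = t pt4 -> s = t.
Proof. by move=> e1 e2 e3 e4; apply: trans_ext => i; case: (ord4P i) => ->. Qed.

Lemma tr4_eta (s : trans 4) : s = tr4 (s pt1) (s pt2) (s pt3) (s pt4).
Proof. by apply: trans4_ext; rewrite !tr4E. Qed.

Lemma tr4M i j k l s : tr4 i j k l * s = tr4 (s i) (s j) (s k) (s l).
Proof. by apply: trans4_ext; rewrite transM !tr4E. Qed.

Lemma tr4_1 : 1 = tr4 pt1 pt2 pt3 pt4.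
Proof. by rewrite [LHS]tr4_eta !trans1. Qed.

Implicit Types (g h k l p : 'S_4) (s t e : trans 4).

Definition swap12 : 'S_4 := tperm pt1 pt2.
Definition cycle123 : 'S_4 := tperm pt1 pt2 * tperm pt1 pt3.

Ltac eval_perm := apply: trans4_ext; rewrite trans_of_permE !tr4E ?permM;
  apply: val_inj; do !rewrite permE /=.

Lemma swap12E : trans_of_perm swap12 = tr4 pt2 pt1 pt3 pt4.
Proof. by eval_perm. Qed.

Lemma cycle123E : trans_of_perm cycle123 = tr4 pt2 pt3 pt1 pt4.
Proof. by eval_perm. Qed.

Lemma swap12_invol : trans_of_perm swap12 * trans_of_perm swap12 = 1.
Proof. by rewrite swap12E tr4_1 !(tr4M, tr4E). Qed.

Lemma odd_swap12 : odd_perm swap12.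
Proof. by rewrite odd_tperm. Qed.

Lemma odd_cycle123 : odd_perm cycle123 = false.
Proof. by rewrite odd_permM !odd_tperm. Qed.

Lemma cycle123_cube : cycle123 * cycle123 * cycle123 = 1.
Proof.
apply: (@trans_of_perm_inj 4); rewrite !(trans_of_permM _ cycle123) cycle123E.
by rewrite !(tr4M, tr4E) trans_of_perm1 tr4_1.
Qed.

Definition Klein_tr : seq (trans 4) :=
  [:: tr4 pt1 pt2 pt3 pt4; tr4 pt2 pt1 pt4 pt3;
      tr4 pt3 pt4 pt1 pt2; tr4 pt4 pt3 pt2 pt1].

Lemma mem_Klein k : (k \in Klein) = (trans_of_perm k \in Klein_tr).
Proof.
have E1 : tr4 pt1 pt2 pt3 pt4 = trans_of_perm 1 by rewrite trans_of_perm1 tr4_1.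
have E2 : tr4 pt2 pt1 pt4 pt3 = trans_of_perm (tperm pt1 pt2 * tperm pt3 pt4).
  by symmetry; eval_perm.
have E3 : tr4 pt3 pt4 pt1 pt2 = trans_of_perm (tperm pt1 pt3 * tperm pt2 pt4).
  by symmetry; eval_perm.
have E4 : tr4 pt4 pt3 pt2 pt1 = trans_of_perm (tperm pt1 pt4 * tperm pt2 pt3).
  by symmetry; eval_perm.
by rewrite !inE E1 E2 E3 E4 !(inj_eq (@trans_of_perm_inj 4)) -!orbA.
Qed.

Lemma KleinM k k' : k \in Klein -> k' \in Klein -> k * k' \in Klein.
Proof.
rewrite !mem_Klein trans_of_permM !inE.
by do 2!case/or4P=> /eqP->; rewrite tr4M !tr4E eqxx ?orbT.
Qed.

Lemma Klein_invol k : k \in Klein -> k * k = 1.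
Proof.
rewrite mem_Klein => K_k; apply: (@trans_of_perm_inj 4).
rewrite trans_of_permM trans_of_perm1 tr4_1; move: K_k; rewrite !inE.
by case/or4P=> /eqP->; rewrite tr4M !tr4E.
Qed.

Lemma KleinV k : k \in Klein -> k^-1 \in Klein.
Proof. by move=> K_k; rewrite (mulg1_eq (Klein_invol K_k)). Qed.

Lemma Klein1 : 1 \in Klein.
Proof. by rewrite !inE eqxx. Qed.

(** The non-trivial elements of the Klein group are the involutions without
    fixed points, a description that is stable under conjugation. *)
Lemma fixfree_invol_Klein k :
  k * k = 1 -> (forall i, k i != i) -> k \in Klein.
Proof.
move=> kk k_free; rewrite mem_Klein !inE.
have kkE i : k (k i) = i by rewrite -permM kk perm1.
have other i j m : k i = j -> (k m == i = (m == j)) * (k m == j = (m == i)).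
  by move=> <-; rewrite (inj_eq perm_inj) -{1}[i]kkE (inj_eq perm_inj).
rewrite [trans_of_perm k]tr4_eta !trans_of_permE.
have k21 : k (k pt1) = pt1 := kkE pt1.
case: (ord4P (k pt1)) => k1; rewrite k1 in k21.
- by have := k_free pt1; rewrite k1.
- have: k pt3 = pt4.
    have [+ +] := other _ _ pt3 k1; have := k_free pt3.
    by case: (ord4P (k pt3)) => -> //= _; rewrite /eq_op /=.
  move=> k3; have k4 : k pt4 = pt3 by rewrite -k3 kkE.
  by rewrite k1 k21 k3 k4 eqxx orbT.
- have: k pt2 = pt4.
    have [+ +] := other _ _ pt2 k1; have := k_free pt2.
    by case: (ord4P (k pt2)) => -> //= _; rewrite /eq_op /=.
  move=> k2; have k4 : k pt4 = pt2 by rewrite -k2 kkE.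
  by rewrite k1 k21 k2 k4 eqxx !orbT.
- have: k pt2 = pt3.
    have [+ +] := other _ _ pt2 k1; have := k_free pt2.
    by case: (ord4P (k pt2)) => -> //= _; rewrite /eq_op /=.
  move=> k2; have k3 : k pt3 = pt2 by rewrite -k2 kkE.
  by rewrite k1 k21 k2 k3 eqxx !orbT.
Qed.

Lemma Klein_fixfree k i : k \in Klein -> k != 1 -> k i != i.
Proof.
rewrite mem_Klein -(inj_eq (@trans_of_perm_inj 4)) trans_of_perm1 tr4_1 !inE.
rewrite -trans_of_permE.
by case/or4P=> /eqP->; rewrite ?eqxx // => _; case: (ord4P i) => ->; rewrite !tr4E.
Qed.

Lemma KleinJ k g : k \in Klein -> k ^ g \in Klein.
Proof.
move=> K_k; have [->|nt_k] := eqVneq k 1; first by rewrite conj1g Klein1.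
apply: fixfree_invol_Klein => [|i]; first by rewrite -conjMg Klein_invol ?conj1g.
rewrite -{1 2}[i](permKV g) permJ (inj_eq perm_inj).
exact: Klein_fixfree.
Qed.

Lemma p_perm_fix g : p_perm g pt4 = pt4.
Proof. by have := p_permP g (p_perm g); rewrite eqxx => /andP[_ /eqP]. Qed.

Lemma p_perm_Klein g : exists2 k, k \in Klein & p_perm g = k * g.
Proof.
have := p_permP g (p_perm g); rewrite eqxx mem_rcoset => /andP[K_k _].
by exists (p_perm g * g^-1); rewrite ?mulgKV.
Qed.

Lemma p_perm_uniq k g p : k \in Klein -> p = k * g -> p pt4 = pt4 -> p_perm g = p.
Proof.
move=> K_k p_kg p4; apply/esym/eqP.
by rewrite -p_permP p4 eqxx andbT mem_rcoset p_kg mulgK.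
Qed.

Lemma p_permM : {morph p_perm : g h / g * h}.
Proof.
move=> g h; have [k K_k Dg] := p_perm_Klein g; have [l K_l Dh] := p_perm_Klein h.
apply: (@p_perm_uniq (k * l ^ g^-1)); first by rewrite KleinM ?KleinJ.
  by rewrite Dg Dh conjgE invgK !mulgA mulgKV.
by rewrite permM !p_perm_fix.
Qed.

Lemma p_permJ : {morph p_perm : g h / g ^ h}.
Proof.
by move=> g h; apply: (mulgI (p_perm h)); rewrite -p_permM -!conjgC p_permM.
Qed.

Lemma p_perm_stab g : g pt4 = pt4 -> p_perm g = g.
Proof. by apply: (p_perm_uniq Klein1); rewrite mul1g. Qed.

Lemma p_perm_ker k : k \in Klein -> p_perm k = 1.
Proof.
by move=> K_k; apply: (p_perm_uniq K_k); rewrite ?perm1 ?Klein_invol.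
Qed.

Lemma Klein_even k : k \in Klein -> ~~ odd_perm k.
Proof.
by rewrite !inE -!orbA => /or4P[]/eqP->; rewrite ?odd_perm1 // odd_permM !odd_tperm.
Qed.

Lemma odd_p_perm g : odd_perm (p_perm g) = odd_perm g.
Proof.
by have [k /Klein_even/negPf K_k ->] := p_perm_Klein g; rewrite odd_permM K_k.
Qed.

(** A list of the six elements of the stabiliser of [pt4], as powers of a
    3-cycle times powers of a transposition, so that a morphism on this
    stabiliser is known from its values on two elements. *)
Lemma stab_pt4P p : p pt4 = pt4 -> exists2 c,
  c \in [:: 1; cycle123; cycle123 * cycle123] & p = c \/ p = c * swap12.
Proof.
move=> p4; have injp := @perm_inj _ p.
have Dp : trans_of_perm p = tr4 (p pt1) (p pt2) (p pt3) pt4.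
  by rewrite [LHS]tr4_eta !trans_of_permE p4.
suff: [\/ trans_of_perm p = trans_of_perm 1,
          trans_of_perm p = trans_of_perm cycle123
        | trans_of_perm p = trans_of_perm (cycle123 * cycle123)] \/
      [\/ trans_of_perm p = trans_of_perm swap12,
          trans_of_perm p = trans_of_perm (cycle123 * swap12)
        | trans_of_perm p = trans_of_perm (cycle123 * cycle123 * swap12)].
  case=> [] [] /trans_of_perm_inj ->.
  - by exists 1; [rewrite inE eqxx | left].
  - by exists cycle123; [rewrite !inE eqxx orbT | left].
  - by exists (cycle123 * cycle123); [rewrite !inE eqxx !orbT | left].
  - by exists 1; [rewrite inE eqxx | right; rewrite mul1g].
  - by exists cycle123; [rewrite !inE eqxx orbT | right].
  - by exists (cycle123 * cycle123); [rewrite !inE eqxx !orbT | right].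
rewrite !(trans_of_permM _ swap12) !(trans_of_permM cycle123) trans_of_perm1 tr4_1.
rewrite swap12E cycle123E !(tr4M, tr4E) Dp.
have n4 i : i != pt4 -> p i != pt4 by rewrite -{2}p4 (inj_eq injp).
have n12 : p pt1 != p pt2 by rewrite (inj_eq injp).
have n13 : p pt1 != p pt3 by rewrite (inj_eq injp).
have n23 : p pt2 != p pt3 by rewrite (inj_eq injp).
have := n4 pt1 isT; have := n4 pt2 isT; have := n4 pt3 isT.
move: n12 n13 n23.
case: (ord4P (p pt1)) => ->; case: (ord4P (p pt2)) => -> //;
  case: (ord4P (p pt3)) => -> // *; try by [left; constructor];
  by [left; constructor 2 | left; constructor 3 | right; constructor 1
     | right; constructor 2 | right; constructor 3].
Qed.

(** * The endomorphisms of rank seven *)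

Lemma sigma_perm g : sigma (trans_of_perm g) = trans_of_perm (p_perm g).
Proof.
rewrite /sigma; case: pickP => [h /eqP/trans_of_perm_inj-> //|/(_ g)].
by rewrite eqxx.
Qed.

Lemma sigma_sing s : s \notin Sym_tr 4 -> sigma s = cst pt4.
Proof.
rewrite /sigma; case: pickP => // h /eqP <-.
by rewrite mem_Sym_tr.
Qed.

Lemma sigmaM s t : sigma (s * t) = sigma s * sigma t.
Proof.
have [[g ->]|sing_s] := perm_or_sing s; last first.
  have [[h ->]|sing_t] := perm_or_sing t; last first.
    by rewrite !sigma_sing ?Sym_trM ?(negPf sing_s) // mul_cst.
  rewrite [LHS]sigma_sing ?Sym_trM ?(negPf sing_s) // (sigma_sing sing_s).
  rewrite sigma_perm cst_mul.
  by rewrite trans_of_permE p_perm_fix.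
have [[h ->]|sing_t] := perm_or_sing t; last first.
  rewrite [in RHS](sigma_sing sing_t) mul_cst sigma_sing //.
  by rewrite Sym_trM (negPf sing_t) andbF.
by rewrite -trans_of_permM !sigma_perm p_permM trans_of_permM.
Qed.

HB.lock Definition sig (g : 'S_4) : tend 4 := mk_end (sigma_conj g).

Lemma sig_fun g : tend_fun (sig g) = sigma_conj g.
Proof. by rewrite sig.unlock; apply: mk_endE => s t; rewrite !ffunE sigmaM tconjM. Qed.

Lemma sigE g s : sig g s = tconj (sigma s) g.
Proof. by rewrite sig_fun ffunE. Qed.

Lemma sig_perm g h : sig g (trans_of_perm h) = trans_of_perm (p_perm h ^ g).
Proof. by rewrite sigE sigma_perm tconj_perm. Qed.

Lemma sig_sing g s : s \notin Sym_tr 4 -> sig g s = cst (g pt4).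
Proof. by move=> sing_s; rewrite sigE sigma_sing // tconj_cst. Qed.

Lemma cst_sing i : cst i \notin Sym_tr 4.
Proof. by apply/Sym_trP => /(_ pt1 pt2); rewrite !cstE => /(_ erefl). Qed.

Lemma sig_mul_psi g h : sig g * psi h = sig (g * h).
Proof. by apply: tend_ext => s; rewrite tend_mulE psiE !sigE tconj_comp. Qed.

Lemma psi_mul_sig h g : psi h * sig g = sig (p_perm h * g).
Proof.
apply: tend_ext => s; rewrite tend_mulE psiE.
have [[k ->]|sing_s] := perm_or_sing s; last first.
  by rewrite !sig_sing ?Sym_tr_conj // permM p_perm_fix.
by rewrite tconj_perm !sig_perm conjgM p_permJ.
Qed.

Lemma sig_mul_sig g h : sig g * sig h = sig (p_perm g * h).
Proof.
have -> : sig g = sig 1 * psi g by rewrite sig_mul_psi mul1g.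
rewrite -mulgA psi_mul_sig.
set k := _ * h.
apply: tend_ext => s; rewrite tend_mulE.
have [[l ->]|sing_s] := perm_or_sing s; last first.
  by rewrite !(sig_sing _ sing_s) sig_sing ?cst_sing.
by rewrite !sig_perm conjg1 (p_perm_stab (p_perm_fix l)).
Qed.

Lemma sig_mul_phi g t e : phi_ok t e -> sig g * phi_end t e = phi_end t e.
Proof.
move=> ok_te; apply: tend_ext => s; rewrite mul_phi_end // phi_endE //.
have [[h ->]|sing_s] := perm_or_sing s; last by rewrite sig_sing // !phi_sing ?cst_sing.
by rewrite sig_perm !phi_perm odd_permJ odd_p_perm.
Qed.

(** * Classification of the endomorphisms *)

(** An endomorphism that separates two constant maps separates all of them,
    because the pairs of distinct points can be sent to each other; it is then
    injective and is determined by the permutation of the constant maps. *)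
Lemma separating_psi (a : tend 4) i :
  a (cst i) != a (cst pt1) -> exists g, a = psi g.
Proof.
move=> sep_i.
have inj_ac : injective (fun j => a (cst j)).
  move=> j k eq_jk; apply/eqP; apply: contraNT sep_i => neq_jk.
  pose s : trans 4 := Trans [ffun m => if m == j then i else pt1].
  have [sj sk] : s j = i /\ s k = pt1.
    by split; rewrite ffunE ?eqxx // eq_sym (negPf neq_jk).
  by rewrite -sj -sk -!cst_mul !tendM eq_jk.
have inj_a : injective a.
  move=> s t eq_a; apply: trans_ext => j; apply: inj_ac => /=.
  by rewrite -!cst_mul !tendM eq_a.
have [a' aK a'K] := injF_bij inj_a.
have acE j : a (cst j) = cst (a (cst j) pt1).
  by rewrite -cst_mul -[in RHS](a'K (cst pt1)) -tendM mul_cst.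
pose p j := a (cst j) pt1.
have inj_p : injective p.
  by move=> j k eq_p; apply: inj_ac; rewrite /= acE [RHS]acE -!/(p _) eq_p.
exists (perm inj_p); apply: tend_ext => s; rewrite psiE; apply/eqP/tconjP => j.
rewrite !permE /p.
by rewrite -cst_mul tendM transM.
Qed.

(** If [u] permutes its image with order dividing 4, its cycles there have
    length 1, 2 or 4; a cycle of length 4 would leave no room for the fixed
    point [x]. *)
Lemma fix_order4 (u : trans 4) x :
  u x = x -> u * u * u * u * u = u -> u * u * u = u.
Proof.
move=> ux u5; suff key j : u (u (u (u j))) = j -> u (u j) = j.
  apply: trans_ext => i; rewrite !transM; apply: key.
  by rewrite -!transM !mulgA u5.
move=> u4; apply/eqP; apply: contraT => uuj.
have jx : j != x by apply: contra uuj => /eqP->; rewrite !ux.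
have uj : u j != j by apply: contra uuj => /eqP Ej; rewrite !Ej.
suff /card_uniqP card5 : uniq [:: x; j; u j; u (u j); u (u (u j))].
  have := max_card [in [:: x; j; u j; u (u j); u (u (u j))]].
  by rewrite card5 card_ord.
have u4r y z : u (u (u (u y))) = y -> u (u (u (u z))) = z -> (u y == u z) = (y == z).
  by move=> uy uz; apply/eqP/eqP=> [eq_u | -> //]; rewrite -uy -uz eq_u.
have juuu : j != u (u (u j)).
  by apply: contra uj => /eqP Ej; rewrite {1}Ej u4.
rewrite /= !inE !negb_or !u4r ?u4 // ![j == u j]eq_sym [j == u (u j)]eq_sym.
rewrite uj uuj juuu !andbT.
by do ?[apply/andP; split]; apply: contra jx => /eqP Ex; rewrite -u4 // -Ex !ux.
Qed.

Section CommonConstant.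
Variables (a : tend 4) (d : trans 4).
Hypothesis a_cst : forall i, a (cst i) = d.

Lemma common_cst_mull s : a s * d = d.
Proof. by rewrite -(a_cst pt1) -tendM mul_cst. Qed.

Lemma common_cst_mulr s : d * a s = d.
Proof. by rewrite -{1}(a_cst pt1) -tendM cst_mul. Qed.

Lemma common_fixed_point s : a s (d pt1) = d pt1.
Proof. by rewrite -transM common_cst_mulr. Qed.

(** The double transpositions are the squares of the 4-cycles, and
    [fix_order4] applies to the images of these, since all values of
    [a] fix the point [d pt1]. *)
Lemma Klein_to_a1 (k : trans 4) : k \in Klein_tr -> a k = a 1.
Proof.
have square q : q * q * q * q = 1 -> a (q * q) = a 1.
  move=> q4; rewrite -[in RHS]q4 2!tendM -mulgA.
  rewrite !tendM.
  have a5 : a q * a q * a q * a q * a q = a q.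
    by rewrite -!tendM q4 mul1g.
  by rewrite !mulgA (fix_order4 (common_fixed_point q) a5).
rewrite !inE => /or4P[]/eqP->.
- by rewrite -tr4_1.
- by rewrite -(square (tr4 pt3 pt4 pt2 pt1)) ?tr4_1 !(tr4M, tr4E).
- by rewrite -(square (tr4 pt2 pt3 pt4 pt1)) ?tr4_1 !(tr4M, tr4E).
- by rewrite -(square (tr4 pt2 pt4 pt1 pt3)) ?tr4_1 !(tr4M, tr4E).
Qed.

Lemma Klein_mul (k s : trans 4) : k \in Klein_tr -> a (k * s) = a s.
Proof. by move/Klein_to_a1=> ak; rewrite tendM ak -tendM mul1g. Qed.

Lemma mul_Klein (s k : trans 4) : k \in Klein_tr -> a (s * k) = a s.
Proof. by move/Klein_to_a1=> ak; rewrite tendM ak -tendM mulg1. Qed.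

Lemma idem_Klein (s k : trans 4) : s * s = s -> k \in Klein_tr -> a (s * k * s) = a s.
Proof. by move=> ss K_k; rewrite -mulgA tendM Klein_mul // -tendM ss. Qed.

(** Since [a] does not see the Klein group, [s] and [s * k * s] have the same
    image for [s] idempotent and [k] in this group. Suitable [k] lower the rank
    of [mu] from 2 to 1 and that of [eps] from 3 to 2; multiplication by [del]
    then sends [eps] to [mu] and leaves [rho] fixed. *)
Lemma defect1_common_cst : a (tr4 pt2 pt2 pt3 pt4) = d.
Proof.
set eps := tr4 pt2 pt2 pt3 pt4; pose mu := tr4 pt2 pt2 pt2 pt4.
pose rho := tr4 pt2 pt2 pt4 pt4; pose del := tr4 pt1 pt2 pt2 pt4.
have K4 : tr4 pt4 pt3 pt2 pt1 \in Klein_tr by rewrite !inE eqxx !orbT.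
have K3 : tr4 pt3 pt4 pt1 pt2 \in Klein_tr by rewrite !inE eqxx !orbT.
have a_mu : a mu = d.
  rewrite -(@idem_Klein mu _ _ K4) /mu ?(tr4M, tr4E) //.
  by rewrite -(a_cst pt2); congr (a _); apply: trans4_ext; rewrite tr4E cstE.
have a_rho : a rho = a eps.
  rewrite -(@idem_Klein eps _ _ K3) /eps ?(tr4M, tr4E) //.
  by rewrite -(@mul_Klein _ _ K3) ?(tr4M, tr4E).
have -> : a eps = a (rho * del) by rewrite -a_rho /rho /del !(tr4M, tr4E).
by rewrite tendM a_rho -tendM /eps /del !(tr4M, tr4E).
Qed.

(** The image of [s] is determined by any right identity of [s]; the conjugates
    by the Klein group of the idempotent in [defect1_common_cst] move each of
    the four points, so one of them moves only a point missed by [s]. *)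
Lemma sing_common_cst s : s \notin Sym_tr 4 -> a s = d.
Proof.
have reduce t : s * t = s -> a t = d -> a s = d.
  by move=> <- at_d; rewrite tendM at_d common_cst_mull.
have Kconj (k : trans 4) : k \in Klein_tr -> a (k * tr4 pt2 pt2 pt3 pt4 * k) = d.
  by move=> K_k; rewrite mul_Klein // Klein_mul // defect1_common_cst.
case/singular_misses=> j miss_j.
suff [k K_k sk] : exists2 k : trans 4, k \in Klein_tr &
    forall i, i != j -> (k * tr4 pt2 pt2 pt3 pt4 * k) i = i.
  apply: reduce (Kconj k K_k).
  by apply: trans_ext => i; rewrite transM sk.
have [|||] := ord4P j => ->.
- exists (tr4 pt1 pt2 pt3 pt4); first by rewrite !inE eqxx ?orbT.
  by move=> i; case: (ord4P i) => ->; rewrite !transM !tr4E.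
- exists (tr4 pt2 pt1 pt4 pt3); first by rewrite !inE eqxx ?orbT.
  by move=> i; case: (ord4P i) => ->; rewrite !transM !tr4E.
- exists (tr4 pt3 pt4 pt1 pt2); first by rewrite !inE eqxx ?orbT.
  by move=> i; case: (ord4P i) => ->; rewrite !transM !tr4E.
- exists (tr4 pt4 pt3 pt2 pt1); first by rewrite !inE eqxx ?orbT.
  by move=> i; case: (ord4P i) => ->; rewrite !transM !tr4E.
Qed.

Lemma end_p_perm g : a (trans_of_perm g) = a (trans_of_perm (p_perm g)).
Proof.
have [k K_k ->] := p_perm_Klein g.
by rewrite trans_of_permM Klein_mul // -mem_Klein.
Qed.

(** The Klein group and the 3-cycles generate the alternating group, so an
    endomorphism that collapses both sees only the parity of a permutation. *)
Lemma trivial_cycle_phi : a (trans_of_perm cycle123) = a 1 ->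
  exists t e, phi_ok t e /\ a = phi_end t e.
Proof.
move=> ac; exists (a (trans_of_perm swap12)), d.
have ok_a : phi_ok (a (trans_of_perm swap12)) d.
  have dd : d * d = d by have := common_cst_mulr (cst pt1); rewrite a_cst.
  by rewrite /phi_ok -!tendM swap12_invol mul1g common_cst_mull common_cst_mulr dd !eqxx.
split=> //; apply: tend_ext => s; rewrite phi_endE //.
have [[g ->]|sing_s] := perm_or_sing s; last by rewrite phi_sing // sing_common_cst.
rewrite end_p_perm phi_perm -odd_p_perm -tendM swap12_invol.
have acc : a (trans_of_perm (cycle123 * cycle123)) = a 1.
  by rewrite trans_of_permM tendM ac -tendM mul1g.
have [c c_in Dp] := stab_pt4P (p_perm_fix g).
have [odd_c a_c] : odd_perm c = false /\ a (trans_of_perm c) = a 1.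
  move: c_in; rewrite !inE; case/or3P=> /eqP->; split=> //.
  - exact: odd_perm1.
  - by rewrite trans_of_perm1.
  - exact: odd_cycle123.
  - by rewrite odd_permM addbb.
case: Dp => ->; first by rewrite odd_c a_c.
by rewrite odd_permM odd_c odd_swap12 /= trans_of_permM tendM a_c -tendM mul1g.
Qed.

(** Otherwise the image [c] of the 3-cycle moves three points in a cycle, and the
    fourth is the point [x] fixed by all the values of [a]. The image [t] of
    the transposition inverts [c], so it fixes a point [z] of the cycle. Calling
    [x] and [z] the points 4 and 3, and numbering 1 and 2 along the cycle, makes
    [c] and [t] the given 3-cycle and transposition. *)
Lemma faithful_cycle_sig : a (trans_of_perm cycle123) != a 1 ->
  exists g, a = sig g.
Proof.
set c := a (trans_of_perm cycle123); set t := a (trans_of_perm swap12).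
set x := d pt1 => neq_c1.
have cx : c x = x := common_fixed_point _.
have tx : t x = x := common_fixed_point _.
have ccc : c * c * c = a 1.
  by rewrite -!tendM; congr (a _); rewrite cycle123E tr4_1 !(tr4M, tr4E).
have tt : t * t = a 1 by rewrite -tendM swap12_invol.
have ctc : c * t * c = t.
  by rewrite -!tendM; congr (a _); rewrite cycle123E swap12E !(tr4M, tr4E).
have a1c : a 1 * c = c by rewrite -tendM mul1g.
have ca1 : c * a 1 = c by rewrite -tendM mulg1.
(* [y] is taken in the image of [a 1], on which [c] acts as a permutation *)
have [y [a1y cy]] : exists y, a 1 y = y /\ c y != y.
  suff /existsP[i ci] : [exists i, c i != a 1 i].
    by exists (a 1 i); rewrite -!transM a1c -tendM mulg1.
  apply: contraNT neq_c1 => /existsPn ca.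
  by apply/eqP/trans_ext=> i; apply/eqP/negPn/ca.
have c3 i : c (c (c i)) = a 1 i by rewrite -!transM mulgA ccc.
have uniq_orb z : a 1 z = z -> c z != z -> uniq [:: c z; c (c z); z; x].
  move=> a1z cz.
  have zx : z != x by apply: contra cz => /eqP->; rewrite cx.
  have c3z : c (c (c z)) = z by rewrite c3.
  have ccz : c (c z) != z by apply: contra cz => /eqP Ez; rewrite -{2}c3z Ez.
  have cczc : c z != c (c z).
    by apply: contra ccz => /eqP Ez; rewrite -[X in _ == X]c3z -!Ez.
  have cx_inj i : c (c (c i)) = i -> c i = x -> i = x by move=> {2}<- ->; rewrite !cx.
  have czx : c z != x by apply: contra zx => /eqP/cx_inj->.
  have cczx : c (c z) != x by apply: contra czx => /eqP/cx_inj->; rewrite ?c3z.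
  by rewrite /= !inE !negb_or cczc cz czx ccz cczx zx.
have cover z i : a 1 z = z -> c z != z -> i \in [:: c z; c (c z); z; x].
  move=> a1z /(uniq_orb z a1z)/card_uniqP card4.
  have card_eq : #|[:: c z; c (c z); z; x]| = #|'I_4| by rewrite card4 card_ord.
  have /(subset_cardP card_eq)-> // : [:: c z; c (c z); z; x] \subset 'I_4.
  exact/subsetP.
have a1_id : a 1 = 1.
  apply: trans_ext => i; rewrite trans1.
  have a1a s j : a 1 (a s j) = a s j by rewrite -transM -tendM mulg1.
  have := cover y i a1y cy; rewrite !inE.
  by case/or4P=> /eqP-> //; rewrite ?a1a // common_fixed_point.
have c3i i : c (c (c i)) = i by rewrite c3 a1_id trans1.
have t2 i : t (t i) = i by rewrite -transM tt a1_id trans1.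
have tc i : t (c i) = c (c (t i)).
  by rewrite -[in RHS]ctc !transM c3i.
have [z [tz cz]] : exists z, t z = z /\ c z != z.
  have cc_y : c (c y) != c y by apply: contra cy => /eqP Ey; rewrite -{2}(c3i y) !Ey.
  have ccc_y : c (c (c y)) != c (c y).
    by apply: contra cc_y => /eqP Ey; rewrite -{2}(c3i (c y)) !Ey.
  have := cover y (t y) a1y cy; rewrite !inE.
  case/or4P=> /eqP ty; last by move: cy; rewrite -(t2 y) ty tx cx eqxx.
  - by exists (c (c y)); split; rewrite // !tc ty !c3i.
  - by exists (c y); split; rewrite // tc ty !c3i.
  - by exists y.
have a1z : a 1 z = z by rewrite a1_id trans1.
pose q (i : 'I_4) := nth x [:: c z; c (c z); z; x] i.
have inj_q : injective q.
  move=> i j /eqP; rewrite nth_uniq ?ltn_ord //; last exact: uniq_orb.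
  by move/eqP/val_inj.
pose g := perm inj_q.
have g_c : c = tconj (trans_of_perm cycle123) g.
  apply/eqP/tconjP=> i; rewrite cycle123E.
  by case: (ord4P i) => ->; rewrite tr4E !permE /q /= ?c3i ?cx.
have g_t : t = tconj (trans_of_perm swap12) g.
  apply/eqP/tconjP=> i; rewrite swap12E.
  by case: (ord4P i) => ->; rewrite tr4E !permE /q /= ?tc ?tz ?c3i ?tx.
have g_1 : a 1 = tconj 1 g by rewrite a1_id -trans_of_perm1 tconj_perm conj1g.
exists g; apply: tend_ext => s.
have [[h ->]|sing_s] := perm_or_sing s; last first.
  rewrite sing_common_cst // sig_sing // permE /q /=; apply: trans_ext => i; rewrite cstE.
  have dc j : c (d j) = d j by rewrite -transM common_cst_mulr.
  have := cover z (d i) a1z cz; rewrite !inE.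
  have c_inj : injective c by move=> j k eq_c; rewrite -(c3i j) eq_c c3i.
  case/or4P=> /eqP Ei //; have := dc i; rewrite Ei => Ec.
  - by rewrite (c_inj _ _ Ec) eqxx in cz.
  - by rewrite (c_inj _ _ (c_inj _ _ Ec)) eqxx in cz.
  - by rewrite Ec eqxx in cz.
rewrite end_p_perm sig_perm -tconj_perm.
have [k k_in Dp] := stab_pt4P (p_perm_fix h).
have a_k : a (trans_of_perm k) = tconj (trans_of_perm k) g.
  move: k_in; rewrite !inE; case/or3P=> /eqP->.
  - by rewrite trans_of_perm1.
  - exact: g_c.
  - by rewrite (trans_of_permM cycle123) tendM tconjM -g_c.
case: Dp => ->; first exact: a_k.
by rewrite trans_of_permM tendM tconjM a_k -g_t.
Qed.

End CommonConstant.

(** The alternative is whether [a] separates the constant maps. If it does not,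
    its values on the permutations all fix a point, hence act on at most three
    others, and the kernel contains the Klein group. *)
Theorem tend4_cases (a : tend 4) :
  [\/ exists g, a = psi g, exists g, a = sig g
    | exists t e, phi_ok t e /\ a = phi_end t e].
Proof.
have [/forallP a_cst|/forallPn[i sep_i]] :=
  boolP [forall i, a (cst i) == a (cst pt1)]; last first.
  by constructor 1; apply: separating_psi sep_i.
have {}a_cst i : a (cst i) = a (cst pt1) by apply/eqP.
have [triv_c|faith_c] := eqVneq (a (trans_of_perm cycle123)) (a 1).
  by constructor 3; apply: trivial_cycle_phi a_cst triv_c.
by constructor 2; apply: faithful_cycle_sig a_cst faith_c.
Qed.

(** * Membership in the families *)

Section AdmissiblePairs.
Variables (t e : trans 4).
Hypothesis ok_te : phi_ok t e.

Lemma ok_ttt : t * t * t = t. Proof. by have /and4P[/eqP] := ok_te. Qed.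
Lemma ok_te_e : t * e = e. Proof. by have /and4P[_ /eqP] := ok_te. Qed.
Lemma ok_et_e : e * t = e. Proof. by have /and4P[_ _ /eqP] := ok_te. Qed.
Lemma ok_ee : e * e = e. Proof. by have /and4P[_ _ _ /eqP] := ok_te. Qed.

Lemma ok_sq : phi_ok (t * t) e.
Proof.
apply/and4P; split; apply/eqP.
- by rewrite !mulgA !ok_ttt.
- by rewrite -mulgA !ok_te_e.
- by rewrite mulgA !ok_et_e.
- exact: ok_ee.
Qed.

Lemma ok_e : phi_ok e e.
Proof. by rewrite /phi_ok !ok_ee eqxx. Qed.

Lemma ok_sqsq : phi_ok (t * t) (t * t).
Proof. by rewrite /phi_ok !mulgA !ok_ttt !eqxx. Qed.

Lemma idem_Sym u : u \in Sym_tr 4 -> u * u = u -> u = 1.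
Proof.
case/imsetP=> g _ ->; rewrite -trans_of_permM => /trans_of_perm_inj gg.
by rewrite (_ : g = 1) ?trans_of_perm1 //; apply: (mulgI g); rewrite gg mulg1.
Qed.

Lemma ok_sing_e : t != e -> e \notin Sym_tr 4.
Proof.
apply: contra => e_perm; have e1 := idem_Sym e_perm ok_ee.
by rewrite -ok_te_e e1 mulg1.
Qed.

Lemma ok_tt_e : (t * t == e) = (t == e).
Proof.
apply/eqP/eqP=> [tt | ->]; last exact: ok_ee.
by rewrite -ok_ttt tt ok_et_e.
Qed.

Lemma ok_idem_e : t == e -> t == t * t.
Proof. by move=> /eqP->; rewrite ok_ee. Qed.

(** As the image of [e] is fixed by [t], an even permutation [t] is an
    involution with a fixed point, hence trivial. *)
Lemma ok_even g : t = trans_of_perm g -> ~~ odd_perm g -> t = 1.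
Proof.
move=> tg even_g; rewrite tg.
have gx : g (e pt1) = e pt1.
  by rewrite -trans_of_permE -tg -transM ok_et_e.
have ggg : g * g * g = g.
  by apply: (@trans_of_perm_inj 4); rewrite !trans_of_permM -tg ok_ttt.
pose h := tperm (e pt1) pt4.
have fix4 : (g ^ h) pt4 = pt4 by rewrite -{1}(tpermL (e pt1) pt4) permJ gx tpermL.
have [c c_in Dg] := stab_pt4P fix4.
have ccc : c * c * c = 1.
  move: c_in; rewrite !inE; case/or3P=> /eqP->; first by rewrite !mulg1.
    exact: cycle123_cube.
  have cube_sq (x : 'S_4) : x * x * x = 1 -> x * x * (x * x) * (x * x) = 1.
    by move=> xxx; rewrite !mulgA xxx mul1g xxx.
  exact/cube_sq/cycle123_cube.
have odd_c : odd_perm c = false.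
  move: c_in; rewrite !inE; case/or3P=> /eqP->.
  - exact: odd_perm1.
  - exact: odd_cycle123.
  - by rewrite odd_permM addbb.
have {Dg} Dg : g ^ h = c.
  case: Dg => // Dg; move: even_g; rewrite -(odd_permJ g h) Dg.
  by rewrite odd_permM odd_c odd_swap12.
have: c * c * c = c by rewrite -Dg -!conjMg ggg.
by rewrite ccc -Dg => /esym/eqP; rewrite conjg_eq1 => /eqP->; rewrite trans_of_perm1.
Qed.

Lemma ok_idem_Sym : (t \in Sym_tr 4) && (t == t * t) = (t == 1).
Proof.
apply/andP/eqP=> [[t_perm /eqP/esym]|->]; first exact: idem_Sym.
by rewrite mulg1 -trans_of_perm1 mem_Sym_tr.
Qed.

Lemma ok_odd : (t \in Sym_tr 4 :\: Alt_tr 4) = (t \in Sym_tr 4) && (t != t * t).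
Proof.
rewrite inE andbC; have [/imsetP[g _ tg]|//] := boolP (t \in Sym_tr 4).
rewrite /= {1}tg mem_Alt_tr negbK; apply/idP/idP=> [odd_g | ].
  apply/negP=> /eqP/esym tt; move: odd_g.
  have /eqP : trans_of_perm g = trans_of_perm 1.
    by rewrite trans_of_perm1 -tg; apply: idem_Sym; rewrite // tg mem_Sym_tr.
  by rewrite (inj_eq (@trans_of_perm_inj 4)) => /eqP->; rewrite odd_perm1.
by apply: contraR => /(ok_even tg) ->; rewrite mulg1.
Qed.

End AdmissiblePairs.

Lemma phi_inj t e (t' e' : trans 4) : phi t e = phi t' e' -> t = t' /\ e = e'.
Proof.
move=> eq_phi; split.
  have := congr1 (fun F : {ffun trans 4 -> trans 4} => F (trans_of_perm swap12)) eq_phi.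
  by rewrite !phi_perm odd_swap12.
have := congr1 (fun F : {ffun trans 4 -> trans 4} => F (cst pt1)) eq_phi.
by rewrite !phi_sing ?cst_sing.
Qed.

Lemma phi_end_inj t e (t' e' : trans 4) : phi_ok t e -> phi_ok t' e' ->
  phi_end t e = phi_end t' e' -> t = t' /\ e = e'.
Proof. by move=> ok ok' eq_phi; apply: phi_inj; rewrite -!phi_endE ?eq_phi. Qed.

Lemma psi_neq_phi g t e : tend_fun (psi g) <> phi t e.
Proof.
move=> eq_phi; have: psi g (cst pt1) = psi g (cst pt2).
  by rewrite eq_phi !phi_sing ?cst_sing.
by move/(AutT_inj (psi_Aut g))/cst_inj.
Qed.

Lemma sig_neq_phi g t e : tend_fun (sig g) <> phi t e.
Proof.
move=> eq_phi.
have: sig g (trans_of_perm cycle123) = sig g (trans_of_perm 1).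
  by rewrite eq_phi !phi_perm odd_cycle123 odd_perm1.
have c4 : cycle123 pt4 = pt4 by rewrite -trans_of_permE cycle123E tr4E.
rewrite !sig_perm !p_perm_stab ?perm1 // => /trans_of_perm_inj/conjg_inj Dc.
by have := tr4E pt2 pt3 pt1 pt4; rewrite -cycle123E trans_of_permE Dc perm1 => [[[[]]]].
Qed.

Lemma psi_neq_sig g h : psi g <> sig h.
Proof.
move=> eq_sig; have: psi g (cst pt1) = psi g (cst pt2).
  by rewrite eq_sig !sig_sing ?cst_sing.
by move/(AutT_inj (psi_Aut g))/cst_inj.
Qed.

Lemma D4P (a : tend 4) : reflect (exists g, a = sig g) (a \in D4).
Proof.
rewrite inE; apply: (iffP existsP) => [[g /eqP Da]|[g ->]]; exists g.
  by apply: val_inj; rewrite /= Da sig_fun.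
by rewrite sig_fun.
Qed.

Lemma mem_phi_end (P : trans 4 -> trans 4 -> bool) t e :
  phi_ok t e -> (phi_end t e \in phi_family P) = P t e.
Proof.
move=> ok_te; rewrite inE phi_endE //.
apply/existsP/idP=> [[u /existsP[f /andP[/eqP/phi_inj[<- <-]]]] // | Pte].
by exists t; apply/existsP; exists e; rewrite eqxx.
Qed.

Lemma psi_notin_family (P : trans 4 -> trans 4 -> bool) g :
  (psi g \in phi_family P) = false.
Proof.
rewrite inE; apply/existsP=> [[u /existsP[f /andP[/eqP Eu _]]]].
exact: psi_neq_phi Eu.
Qed.

Lemma sig_notin_family (P : trans 4 -> trans 4 -> bool) g :
  (sig g \in phi_family P) = false.
Proof.
rewrite inE; apply/existsP=> [[u /existsP[f /andP[/eqP Eu _]]]].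
exact: sig_neq_phi Eu.
Qed.

Lemma sig_notin_Aut g : (sig g \in AutT 4) = false.
Proof.
apply/negP=> /AutT_inj/(_ (cst pt1) (cst pt2)).
by rewrite !sig_sing ?cst_sing // => /(_ erefl)/cst_inj.
Qed.

Lemma psi_notin_D4 g : (psi g \in D4) = false.
Proof. by apply/D4P=> [[h /psi_neq_sig]]. Qed.

Lemma phi_end_notin_Aut t e : phi_ok t e -> (phi_end t e \in AutT 4) = false.
Proof.
move=> ok_te; apply/negP=> /AutT_inj/(_ (cst pt1) (cst pt2)).
by rewrite phi_endE // !phi_sing ?cst_sing // => /(_ erefl)/cst_inj.
Qed.

Lemma phi_end_notin_D4 t e : phi_ok t e -> (phi_end t e \in D4) = false.
Proof.
move=> ok_te; apply/D4P=> [[g /(congr1 (@tend_fun 4))]].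
by rewrite phi_endE // => /esym/sig_neq_phi.
Qed.

Lemma mem_psi g :
  (psi g \in AutT 4) * ((psi g \in D4) = false) * ((psi g \in E1 4) = false) *
  ((psi g \in E2 4) = false) * ((psi g \in E3 4) = false) *
  ((psi g \in Bn 4) = false) * ((psi g \in Cn 4) = false).
Proof. by rewrite psi_Aut psi_notin_D4 !psi_notin_family. Qed.

Lemma mem_sig g :
  ((sig g \in AutT 4) = false) * (sig g \in D4) * ((sig g \in E1 4) = false) *
  ((sig g \in E2 4) = false) * ((sig g \in E3 4) = false) *
  ((sig g \in Bn 4) = false) * ((sig g \in Cn 4) = false).
Proof.
rewrite sig_notin_Aut !sig_notin_family (_ : sig g \in D4) //.
by apply/D4P; exists g.
Qed.

Lemma mem_phi t e : phi_ok t e ->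
  ((phi_end t e \in AutT 4) = false) * ((phi_end t e \in D4) = false) *
  ((phi_end t e \in E1 4) = (t == e)) *
  ((phi_end t e \in E2 4) = [&& t != e, t == t * t & t \in Sym_tr 4]) *
  ((phi_end t e \in E3 4) = [&& t != e, t != t * t & t \in Sym_tr 4]) *
  ((phi_end t e \in Bn 4) = [&& t != e, t != t * t & t \notin Sym_tr 4]) *
  ((phi_end t e \in Cn 4) = [&& t != e, t == t * t & t \notin Sym_tr 4]).
Proof.
move=> ok_te.
rewrite phi_end_notin_Aut // phi_end_notin_D4 // !mem_phi_end // expg2.
rewrite (ok_tt_e ok_te) (ok_odd ok_te).
have := @ok_idem_e t e ok_te; have := ok_sing_e ok_te.
have [<-|neq_te] := eqVneq t e.
  move=> _ /(_ isT) tt; rewrite tt !andbF /=.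
  by do !split; case: (t == 1).
move=> /(_ isT) e_sing _; have -> : e != 1.
  by apply: contra e_sing => /eqP->; rewrite -trans_of_perm1 mem_Sym_tr.
rewrite -(ok_idem_Sym t).
by case: (t \in Sym_tr 4); case: (t == t * t).
Qed.

(** * Products *)

(** The kernels of the endomorphisms are five: those of the automorphisms, of
    D(4), of the [phi_end t e] with [t], [t * t], [e] distinct, of those with
    [t = t * t] other than [e], and of the constant endomorphisms. They are
    numbered in this order, in which no product has a smaller number than a
    factor. Both R* and R~ amount to having the same number. *)
Definition rank_class (a : tend 4) : nat :=
  if a \in AutT 4 then 0 else if a \in D4 then 1%N
  else if a \in E1 4 then 4 else if a \in E2 4 :|: Cn 4 then 3 else 2.

Lemma rank_le4 (a : tend 4) : rank_class a <= 4.
Proof. by rewrite /rank_class; do 4!case: ifP => // _. Qed.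

Lemma rank_psi g : rank_class (psi g) = 0.
Proof. by rewrite /rank_class mem_psi. Qed.

Lemma rank_sig g : rank_class (sig g) = 1%N.
Proof. by rewrite /rank_class !mem_sig. Qed.

Lemma rank_phi t e : phi_ok t e ->
  rank_class (phi_end t e) = if t == e then 4 else if t == t * t then 3 else 2.
Proof.
move=> ok_te; rewrite /rank_class in_setU !mem_phi //.
by case: (t == e); case: (t == _); case: (t \in Sym_tr 4).
Qed.

Lemma AutP (a : tend 4) : reflect (exists g, a = psi g) (a \in AutT 4).
Proof.
apply: (iffP idP) => [|[g ->]]; last exact: psi_Aut.
have [//|[g ->]|[t [e [ok_te ->]]]] := tend4_cases a; first by rewrite mem_sig.
by rewrite mem_phi.
Qed.

Lemma rank_Aut (a : tend 4) : (a \in AutT 4) = (rank_class a == 0).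
Proof.
have [[g ->]|[g ->]|[t [e [ok_te ->]]]] := tend4_cases a.
- by rewrite rank_psi mem_psi.
- by rewrite rank_sig mem_sig.
by rewrite mem_phi // rank_phi //; case: (t == e); case: (t == _).
Qed.

Lemma rank_D4 (a : tend 4) : (a \in D4) = (rank_class a == 1%N).
Proof.
have [[g ->]|[g ->]|[t [e [ok_te ->]]]] := tend4_cases a.
- by rewrite rank_psi mem_psi.
- by rewrite rank_sig mem_sig.
by rewrite mem_phi // rank_phi //; case: (t == e); case: (t == _).
Qed.

Lemma rank_E1 (a : tend 4) : (a \in E1 4) = (rank_class a == 4).
Proof.
have [[g ->]|[g ->]|[t [e [ok_te ->]]]] := tend4_cases a.
- by rewrite rank_psi mem_psi.
- by rewrite rank_sig mem_sig.
by rewrite mem_phi // rank_phi //; case: (t == e); case: (t == _).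
Qed.

Lemma rank_phiP (a : tend 4) : (1 < rank_class a)%N ->
  exists t e, phi_ok t e /\ a = phi_end t e.
Proof.
by have [[g ->]|[g ->]|] := tend4_cases a; rewrite ?rank_psi ?rank_sig.
Qed.

(** A left factor replaces [t] by [t] or [t * t] or [e] and [e] by [e] or
    [t * t]; only these four pairs occur, because [1] is the only idempotent
    permutation. *)
Variant left_multiple t e : tend 4 -> Prop :=
| LeftMultipleSelf : left_multiple t e (phi_end t e)
| LeftMultipleSq : left_multiple t e (phi_end (t * t) e)
| LeftMultipleE : left_multiple t e (phi_end e e)
| LeftMultipleSqSq : left_multiple t e (phi_end (t * t) (t * t)).

Lemma left_multipleP t e (a : tend 4) :
  phi_ok t e -> left_multiple t e (a * phi_end t e).
Proof.
move=> ok_te; have [[g ->]|[g ->]|[u [f [ok_uf ->]]]] := tend4_cases a.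
- by rewrite psi_mul_phi //; constructor.
- by rewrite sig_mul_phi //; constructor.
have [_ ->] := phi_end_mul (phi_end t e) ok_uf; rewrite phi_endE //.
have [f_perm|f_sing] := boolP (f \in Sym_tr 4).
  have Df : f = 1 := idem_Sym f_perm (ok_ee ok_uf).
  have := ok_te_e ok_uf; rewrite Df mulg1 => ->.
  by rewrite phi1; constructor.
rewrite (phi_sing _ _ f_sing); have [[g ->]|u_sing] := perm_or_sing u.
  by rewrite phi_perm; case: (odd_perm g); constructor.
by rewrite phi_sing //; constructor.
Qed.

Lemma rank_mul (c a : tend 4) :
  (rank_class a <= rank_class (c * a)) && (rank_class a <= rank_class (a * c)).
Proof.
have [[g ->]|[g ->]|[t [e [ok_te ->]]]] := tend4_cases a.
- by rewrite rank_psi.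
- by rewrite rank_sig !lt0n -!rank_Aut !AutT_mul mem_sig andbF.
rewrite rank_phi //; apply/andP; split.
  case: (left_multipleP c ok_te); first by rewrite rank_phi.
  - rewrite (rank_phi (ok_sq ok_te)) !mulgA (ok_ttt ok_te) (ok_tt_e ok_te) eqxx.
    by case: (t == e); case: (t == _).
  - by rewrite (rank_phi (ok_e ok_te)) eqxx; case: (t == e); case: (t == _).
  - by rewrite (rank_phi (ok_sqsq ok_te)) eqxx; case: (t == e); case: (t == _).
have [ok_c ->] := phi_end_mul c ok_te; rewrite rank_phi //.
have [->|_] := eqVneq t e; first by rewrite eqxx.
case: eqP => [tt | _]; last by case: (c t == c e); case: (c t == _).
by rewrite -tendM -tt eqxx; case: (c t == c e).
Qed.

Lemma rank_mull (c a : tend 4) : rank_class a <= rank_class (c * a).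
Proof. by have /andP[] := rank_mul c a. Qed.

Lemma rank_mulr (c a : tend 4) : rank_class a <= rank_class (a * c).
Proof. by have /andP[] := rank_mul c a. Qed.

(** * General facts on Green's relations and their generalizations *)

Section GreenFacts.
Variable M : monoidType.
Implicit Types a b c d x : M.

Lemma greenLP a b : greenL a b <-> (exists c, a = c * b) /\ (exists c, b = c * a).
Proof.
split=> [Lab | [[c a_cb] [d b_da]] x].
  by split; apply/Lab; exists 1; rewrite mul1g.
split=> [[k ->]|[k ->]].
  by exists (k * c); rewrite a_cb mulgA.
by exists (k * d); rewrite b_da mulgA.
Qed.

Lemma greenRP a b : greenR a b <-> (exists c, a = b * c) /\ (exists c, b = a * c).
Proof.
split=> [Rab | [[c a_bc] [d b_ad]] x].
  by split; apply/Rab; exists 1; rewrite mulg1.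
split=> [[k ->]|[k ->]].
  by exists (c * k); rewrite a_bc mulgA.
by exists (d * k); rewrite b_ad mulgA.
Qed.

Lemma greenL_starL a b : greenL a b -> starL a b.
Proof.
move/greenLP=> [[k a_kb] [l b_la]] c d.
by split=> eq_cd; [rewrite b_la | rewrite a_kb]; rewrite -!mulgA eq_cd.
Qed.

Lemma starL_tildeL a b : starL a b -> tildeL a b.
Proof. by move=> Lab x _; have := Lab x 1; rewrite !mulg1. Qed.

Lemma starR_tildeR a b : starR a b -> tildeR a b.
Proof. by move=> Rab x _; have := Rab x 1; rewrite !mul1g. Qed.

Lemma greenR_tildeR a b : greenR a b -> tildeR a b.
Proof.
move/greenRP=> [[k a_bk] [l b_al]] x _.
by split=> eq_x; [rewrite b_al | rewrite a_bk]; rewrite mulgA eq_x.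
Qed.

Lemma starL_sym a b : starL a b -> starL b a.
Proof. by move=> Lab c d; apply: iff_sym. Qed.

Lemma starR_sym a b : starR a b -> starR b a.
Proof. by move=> Rab c d; apply: iff_sym. Qed.

Lemma tildeL_sym a b : tildeL a b -> tildeL b a.
Proof. by move=> Lab x idem_x; apply: iff_sym; apply: Lab. Qed.

Lemma tildeR_sym a b : tildeR a b -> tildeR b a.
Proof. by move=> Rab x idem_x; apply: iff_sym; apply: Rab. Qed.

Section Join.
Variables r1 r2 : M -> M -> Prop.

Lemma join1 a b : r1 a b -> rel_join r1 r2 a b.
Proof. by move=> r_ab; apply: rst_step; left. Qed.

Lemma join2 a b : r2 a b -> rel_join r1 r2 a b.
Proof. by move=> r_ab; apply: rst_step; right. Qed.

(** The joins below are bounded from above by exhibiting an invariant. *)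
Lemma join_invariant (F : M -> nat) :
  (forall a b, r1 a b -> F a = F b) -> (forall a b, r2 a b -> F a = F b) ->
  forall a b, rel_join r1 r2 a b -> F a = F b.
Proof.
move=> F1 F2 a b.
elim=> {a b} [a b [/F1|/F2] // | // | a b _ -> // | a b c _ -> _ -> //].
Qed.

Lemma join_saturated I :
  (forall a b, r1 a b -> r1 b a) -> (forall a b, r2 a b -> r2 b a) ->
  saturated r1 I -> saturated r2 I -> forall a b, rel_join r1 r2 a b -> I a <-> I b.
Proof.
move=> sym1 sym2 sat1 sat2 a b.
elim=> {a b} [a b [r_ab|r_ab] | // | a b _ IH | a b c _ IHab _ IHbc].
- by split; [apply: sat1 | apply: sat1 (sym1 _ _ r_ab)].
- by split; [apply: sat2 | apply: sat2 (sym2 _ _ r_ab)].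
- by split=> /IH.
- by split=> [/IHab/IHbc | /IHbc/IHab].
Qed.

End Join.

End GreenFacts.

(** * The relations L and R, and their generalizations R* and R~ *)

(** For [a = sig g] or [a = phi_end u e] all the singular maps have one image;
    it is read off a constant map here. *)
Lemma nonAut_sing (a : tend 4) t : a \notin AutT 4 -> t \notin Sym_tr 4 ->
  a t = a (cst pt4).
Proof.
have [[g ->]|[g ->]|[u [e [ok_ue ->]]]] := tend4_cases a => [|_|_] t_sing.
- by rewrite mem_psi in t_sing.
- by rewrite !sig_sing ?cst_sing.
- by rewrite phi_endE // !phi_sing ?cst_sing.
Qed.

(** A left factor can be cancelled against [a] according to the kernel of [a],
    and [rank_class] determines the kernel. *)
Lemma starR_rank (a b : tend 4) : rank_class a = rank_class b -> starR a b.
Proof.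
move=> eq_rank; suff ker_ab s s' : a s = a s' <-> b s = b s'.
  move=> c d; split=> eq_cd; apply: tend_ext => s; rewrite !tend_mulE;
    by apply/ker_ab; rewrite -!tend_mulE eq_cd.
have [[g Da]|[g Da]|[t [e [ok_te Da]]]] := tend4_cases a;
have [[h Db]|[h Db]|[u [f [ok_uf Db]]]] := tend4_cases b;
  move: eq_rank; rewrite Da Db ?rank_psi ?rank_sig ?rank_phi //;
  try by [case: ifP => // _; case: ifP].
- by split=> [/(AutT_inj (psi_Aut g))->|/(AutT_inj (psi_Aut h))->].
- by rewrite !sigE; split=> [/tconj_inj->|/tconj_inj->].
move=> eq_rank; rewrite !phi_endE //.
have [Eq Ei] : (t == e) = (u == f) /\ (t == t * t) = (u == u * u).
  have := @ok_idem_e _ _ ok_te; have := @ok_idem_e _ _ ok_uf; move: eq_rank.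
  by case: (t == e); case: (u == f); case: (t == _); case: (u == _) => //= _ A B;
    by [have := A isT | have := B isT].
have iffE (x x' y y' : trans 4) : (x == x') = (y == y') -> x = x' <-> y = y'.
  by move=> Exy; split=> /eqP; rewrite (Exy, =^~ Exy) => /eqP.
have Ett := ok_tt_e ok_te; have Euu := ok_tt_e ok_uf.
have [[k ->]|sing_s] := perm_or_sing s; have [[l ->]|sing_s'] := perm_or_sing s';
  rewrite ?phi_perm ?(phi_sing _ _ sing_s) ?(phi_sing _ _ sing_s').
- case: (odd_perm k); case: (odd_perm l) => //; apply: iffE => //.
  by rewrite eq_sym Ei eq_sym.
- by case: (odd_perm k); apply: iffE; rewrite ?Ett ?Euu.
- by case: (odd_perm l); apply: iffE; rewrite ![f == _]eq_sym ![e == _]eq_sym ?Ett ?Euu.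
- by [].
Qed.

Lemma cst4_ok : phi_ok (cst pt4) (cst pt4).
Proof. by rewrite /phi_ok !mul_cst !eqxx. Qed.

Lemma one_cst4_ok : phi_ok 1 (cst pt4).
Proof. by rewrite /phi_ok !mulg1 !mul1g mul_cst !eqxx. Qed.

Lemma swap12_cst4_ok : phi_ok (trans_of_perm swap12) (cst pt4).
Proof.
rewrite /phi_ok swap12_invol mul1g !mul_cst !eqxx cst_mul swap12E.
by rewrite !tr4E eqxx.
Qed.

(** Each ideal [k < rank_class a] consists of the [a] that have a certain
    idempotent as a left identity, which is how R~ detects [rank_class]. *)
Lemma left_identities (a : tend 4) :
  [/\ (0 < rank_class a)%N <-> sig 1 * a = a,
      (1 < rank_class a)%N <-> phi_end (trans_of_perm swap12) (cst pt4) * a = a,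
      (2 < rank_class a)%N <-> phi_end 1 (cst pt4) * a = a
    & (3 < rank_class a)%N <-> phi_end (cst pt4) (cst pt4) * a = a].
Proof.
have up c : c * a = a -> (rank_class c <= rank_class a)%N.
  by move=> <-; apply: rank_mulr.
have sw2 : trans_of_perm swap12 != 1.
  rewrite -trans_of_perm1 (inj_eq (@trans_of_perm_inj 4)); apply/eqP=> sw.
  by have := odd_swap12; rewrite sw odd_perm1.
have psw : phi_ok (trans_of_perm swap12) (cst pt4) := swap12_cst4_ok.
have psc : trans_of_perm swap12 == cst pt4 = false.
  by apply/negP=> /eqP Esw; have := cst_sing pt4; rewrite -Esw mem_Sym_tr.
have p1c : 1 == cst pt4 = false.
  by apply/negP=> /eqP E1; have := cst_sing pt4; rewrite -E1 -trans_of_perm1 mem_Sym_tr.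
split.
- split=> [|/up]; last by rewrite rank_sig.
  have [[g ->]|[g ->]|[t [e [ok_te ->]]]] := tend4_cases a.
  + by rewrite rank_psi.
  + by rewrite sig_mul_sig p_perm_ker ?Klein1 // mul1g.
  + by rewrite sig_mul_phi.
- split=> [/rank_phiP[t [e [ok_te ->]]]|/up]; last first.
    by rewrite rank_phi // psc swap12_invol (negPf sw2).
  have [_ ->] := phi_end_mul (phi_end t e) psw.
  by rewrite !phi_endE // phi_perm odd_swap12 phi_sing ?cst_sing.
- split=> [rk|/up]; last by rewrite rank_phi ?one_cst4_ok // p1c mulg1 eqxx.
  have /rank_phiP[t [e [ok_te Da]]] : (1 < rank_class a)%N by apply: ltnW.
  have tt : t * t = t.
    move: rk; rewrite Da rank_phi //; case: eqP => [-> _|_]; first exact: ok_ee ok_te.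
    by case: eqP.
  have [_ ->] := phi_end_mul a one_cst4_ok.
  by rewrite Da !phi_endE // phi1 tt phi_sing ?cst_sing.
- split=> [rk|/up]; last by rewrite rank_phi ?cst4_ok // eqxx.
  have /rank_phiP[t [e [ok_te Da]]] : (1 < rank_class a)%N by do 2!apply: ltnW.
  have te : t = e.
    by move: rk; rewrite Da rank_phi //; case: eqP => // _; case: eqP.
  have [_ ->] := phi_end_mul a cst4_ok.
  by rewrite Da !phi_endE // phi_sing ?cst_sing // te.
Qed.

Lemma phi_end_idem t e : phi_ok t e -> (t \in Sym_tr 4) || (t == e) ->
  idem (phi_end t e).
Proof.
move=> ok_te perm_or_e; rewrite /idem.
have [_ ->] := phi_end_mul (phi_end t e) ok_te; rewrite phi_endE //.
have [Dte|neq_te] := eqVneq t e.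
  have [e_perm|e_sing] := boolP (e \in Sym_tr 4); last by rewrite Dte !phi_sing.
  by rewrite Dte (idem_Sym e_perm (ok_ee ok_te)) phi1 mulg1.
rewrite (negPf neq_te) orbF in perm_or_e.
rewrite (phi_sing _ _ (ok_sing_e ok_te neq_te)).
case/imsetP: (perm_or_e) => g _ tg; rewrite {2}tg phi_perm.
have [//|/(ok_even ok_te tg) ->] := boolP (odd_perm g).
by rewrite mulg1.
Qed.

Lemma tildeR_rank (a b : tend 4) : tildeR a b <-> rank_class a = rank_class b.
Proof.
split=> [Rab | /starR_rank/starR_tildeR //].
have [a0 a1 a2 a3] := left_identities a; have [b0 b1 b2 b3] := left_identities b.
have idem_sig1 : idem (sig 1).
  by rewrite /idem sig_mul_sig p_perm_ker ?Klein1 // mul1g.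
have perm1 : 1 \in Sym_tr 4 by rewrite -trans_of_perm1 mem_Sym_tr.
have E0 := Rab _ idem_sig1.
have E1 : _ :=
  Rab _ (phi_end_idem swap12_cst4_ok (introT orP (or_introl (mem_Sym_tr _)))).
have E2 : _ := Rab _ (phi_end_idem one_cst4_ok (introT orP (or_introl perm1))).
have E3 : _ := Rab _ (phi_end_idem cst4_ok (introT orP (or_intror (eqxx _)))).
have gtE m : (m < 4)%N -> (m < rank_class a)%N = (m < rank_class b)%N.
  have iffb (x y : bool) : (x <-> y) -> x = y by move=> xy; apply/idP/idP=> /xy.
  case: m => [|[|[|[|//]]]] _; apply: iffb.
  - exact: iff_trans a0 (iff_trans E0 (iff_sym b0)).
  - exact: iff_trans a1 (iff_trans E1 (iff_sym b1)).
  - exact: iff_trans a2 (iff_trans E2 (iff_sym b2)).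
  - exact: iff_trans a3 (iff_trans E3 (iff_sym b3)).
move: (rank_le4 a) (rank_le4 b) (gtE 0 isT) (gtE 1%N isT) (gtE 2 isT) (gtE 3 isT).
by case: (rank_class a) (rank_class b) => [|[|[|[|[|//]]]]] [|[|[|[|[|//]]]]].
Qed.

Lemma starR_rankE (a b : tend 4) : starR a b <-> rank_class a = rank_class b.
Proof. by split=> [/starR_tildeR/tildeR_rank|/starR_rank]. Qed.

Lemma sigma_agreeP g h : g pt4 = h pt4 -> sigma_agree (sig g) (sig h).
Proof. by move=> eq4; exists g, h; rewrite !sig_fun. Qed.

Lemma agree_greenL (a b : tend 4) : sigma_agree a b -> greenL a b.
Proof.
move=> [g [h [Da Db eq4]]].
have {Da} -> : a = sig g by apply: val_inj; rewrite /= Da sig_fun.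
have {Db} -> : b = sig h by apply: val_inj; rewrite /= Db sig_fun.
have mult k l : k pt4 = l pt4 -> exists c, sig k = c * sig l.
  move=> eq_kl; exists (psi (k * l^-1)); rewrite psi_mul_sig p_perm_stab ?mulgKV //.
  by rewrite permM eq_kl permK.
by apply/greenLP; split; apply: mult.
Qed.

(** Mutual left multiples have the same [rank_class], and of the four pairs in
    [left_multiple t e] one that differs from [(t, e)] has a larger one. *)
Lemma greenL_tend4 (a b : tend 4) : greenL a b <->
  [\/ a = b, (a \in AutT 4) && (b \in AutT 4) | sigma_agree a b].
Proof.
split=> [/greenLP[[c a_cb] [d b_da]] | [-> // | | ]]; last first.
- exact: agree_greenL.
- case/andP=> /AutP[g ->] /AutP[h ->]; apply/greenLP; split.
    by exists (psi (g * h^-1)); rewrite psiM mulgKV.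
  by exists (psi (h * g^-1)); rewrite psiM mulgKV.
have rank_ab : rank_class a = rank_class b.
  by apply/eqP; rewrite eqn_leq; apply/andP; split; [rewrite b_da | rewrite a_cb];
     rewrite rank_mull.
have [[h Db]|[h Db]|[t [e [ok_te Db]]]] := tend4_cases b.
- by constructor 2; rewrite !rank_Aut rank_ab Db rank_psi.
- constructor 3; move: a_cb rank_ab; rewrite Db rank_sig.
  have [[g ->]|[g ->]|[t [e [ok_te ->]]]] := tend4_cases c => ->.
  + by rewrite psi_mul_sig => _; apply: sigma_agreeP; rewrite permM p_perm_fix.
  + by rewrite sig_mul_sig => _; apply: sigma_agreeP; rewrite permM p_perm_fix.
  have [ok_h ->] := phi_end_mul (sig h) ok_te.
  by rewrite rank_phi //; case: ifP => // _; case: ifP.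
constructor 1; move: rank_ab; rewrite a_cb Db rank_phi //.
have tt_idem : t == e -> t * t = t by move/(ok_idem_e ok_te)/eqP.
case: (left_multipleP c ok_te) => [//|||].
- rewrite (rank_phi (ok_sq ok_te)) !mulgA (ok_ttt ok_te) (ok_tt_e ok_te) eqxx.
  case: ifP => [/tt_idem->|_] //.
  by case: eqP => // <-.
- by rewrite (rank_phi (ok_e ok_te)) eqxx; case: eqP => [->|_] //; case: eqP.
rewrite (rank_phi (ok_sqsq ok_te)) eqxx; case: eqP => [te|_]; last by case: eqP.
by rewrite tt_idem -?te ?eqxx.
Qed.

Lemma mem_BC_phi t e : phi_ok t e -> (phi_end t e \in Bn 4 :|: Cn 4) =
  (t != e) && (t \notin Sym_tr 4).
Proof.
move=> ok_te; rewrite in_setU !mem_phi //.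
by case: (t == e); case: (t == _); case: (t \in Sym_tr 4).
Qed.

Lemma BC_phi (a : tend 4) : a \in Bn 4 :|: Cn 4 ->
  exists t e, [/\ phi_ok t e, a = phi_end t e, t != e & t \notin Sym_tr 4].
Proof.
have [[g ->]|[g ->]|[t [e [ok_te ->]]]] := tend4_cases a.
- by rewrite in_setU !mem_psi.
- by rewrite in_setU !mem_sig.
by rewrite mem_BC_phi // => /andP[]; exists t, e.
Qed.

(** Both entries of a pair in B or C are singular, and an endomorphism that is
    not an automorphism does not distinguish singular maps; so the product
    forgets the pair. *)
Lemma BC_mul_nonAut (a c : tend 4) : a \in Bn 4 :|: Cn 4 -> c \notin AutT 4 ->
  a * c = phi_end (c (cst pt4)) (c (cst pt4)).
Proof.
move=> /BC_phi[t [e [ok_te -> neq_te t_sing]]] nonAut_c.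
have [_ ->] := phi_end_mul c ok_te.
by rewrite !(nonAut_sing nonAut_c) // (ok_sing_e ok_te neq_te).
Qed.

Lemma E1_end (a : tend 4) s : s * s = s -> phi_end (a s) (a s) \in E1 4.
Proof.
by move=> ss; rewrite mem_phi ?eqxx // /phi_ok -!tendM !ss eqxx.
Qed.

Lemma BC_notin_E1 (a : tend 4) : a \in Bn 4 :|: Cn 4 -> a \notin E1 4.
Proof. by move/BC_phi=> [t [e [ok_te -> neq_te _]]]; rewrite mem_phi. Qed.

Lemma BC_mul_Aut (a c : tend 4) : a \in Bn 4 :|: Cn 4 -> a * c \notin E1 4 ->
  c \in AutT 4.
Proof.
move=> BC_a; apply: contraR => nonAut_c; rewrite BC_mul_nonAut // E1_end //.
exact: mul_cst.
Qed.

Lemma Aut_orbit (a c : tend 4) : c \in AutT 4 -> AutT_orbit_eq a (a * c).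
Proof.
case/AutP=> g ->; apply/setP=> x.
apply/imsetP/imsetP=> [[k /AutP[h ->] ->] | [k Aut_k ->]].
  by exists (psi (g^-1 * h)); rewrite ?psi_Aut // -mulgA psiM mulKVg.
by exists (psi g * k); rewrite ?mulgA // AutT_mul psi_Aut.
Qed.

Lemma orbit_greenR (a b : tend 4) : AutT_orbit_eq a b -> greenR a b.
Proof.
move=> orb; have one_Aut : (1 : tend 4) \in AutT 4 by rewrite -psi1 psi_Aut.
have self (c : tend 4) : c \in [set c * x | x in AutT 4].
  by apply/imsetP; exists 1; rewrite ?mulg1.
apply/greenRP; split.
  by have := self a; rewrite orb => /imsetP[c _ ->]; exists c.
by have := self b; rewrite -orb => /imsetP[c _ ->]; exists c.
Qed.

Lemma orbit_sym (a b : tend 4) : AutT_orbit_eq a b -> AutT_orbit_eq b a.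
Proof. by move/esym. Qed.

(** The relation R refines R~, so [rank_class] separates all but E2 from C and
    E3 from B. In B and C only an automorphism can be undone by a right
    multiplication, by [BC_mul_Aut]. *)
Lemma greenR_tend4 (a b : tend 4) : greenR a b <->
  (exists2 X : {set tend 4}, X \in [:: E1 4; E2 4; E3 4]
                           & (a \in X) && (b \in X)) \/
  [\/ (a \in AutT 4) && (b \in AutT 4), (a \in D4) && (b \in D4)
    | AutT_orbit_eq a b].
Proof.
split=> [Rab | [[X X_in abX] | [/andP[/AutP[g ->] /AutP[h ->]] | | ]]]; last first.
- exact: orbit_greenR.
- case/andP=> /D4P[g ->] /D4P[h ->]; apply/greenRP; split.
    by exists (psi (h^-1 * g)); rewrite sig_mul_psi mulKVg.
  by exists (psi (g^-1 * h)); rewrite sig_mul_psi mulKVg.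
- apply/greenRP; split.
    by exists (psi (h^-1 * g)); rewrite psiM mulKVg.
  by exists (psi (g^-1 * h)); rewrite psiM mulKVg.
- (* the elements of E2 and of E3 are left identities of each other, and
     those of E1 right zeros of each other, so [c = d * c] *)
  suff mult (c d : tend 4) : c \in X -> d \in X -> exists y, c = d * y.
    by case/andP: abX => aX bX; apply/greenRP; split; apply: mult.
  move=> cX dX; exists c; move: cX dX.
  have [[g ->]|[g ->]|[t [e [ok_te ->]]]] := tend4_cases c.
  + by move: X_in; rewrite !inE => /or3P[]/eqP->; rewrite mem_psi.
  + by move: X_in; rewrite !inE => /or3P[]/eqP->; rewrite mem_sig.
  have [[g ->]|[g ->]|[u [f [ok_uf ->]]]] := tend4_cases d.
  + by move: X_in; rewrite !inE => /or3P[]/eqP->; rewrite mem_psi.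
  + by move: X_in; rewrite !inE => /or3P[]/eqP->; rewrite mem_sig.
  have [_ ->] := phi_end_mul (phi_end t e) ok_uf; rewrite phi_endE //.
  move: X_in; rewrite !inE => /or3P[]/eqP->; rewrite !mem_phi //.
  + move=> /eqP Dt /eqP <-; rewrite Dt; have [[g Du]|u_sing] := perm_or_sing u.
      by rewrite Du phi_perm (ok_ee ok_te) if_same.
    by rewrite !phi_sing.
  + case/and3P=> _ /eqP tt _ /and3P[/(ok_sing_e ok_uf) f_sing uu u_perm].
    rewrite (phi_sing _ _ f_sing); have /eqP -> : u == 1.
      by rewrite -ok_idem_Sym u_perm.
    by rewrite phi1 -tt.
  + case/and3P=> _ _ _ /and3P[/(ok_sing_e ok_uf) f_sing u_odd u_perm].
    rewrite (phi_sing _ _ f_sing).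
    have: u \in Sym_tr 4 :\: Alt_tr 4 by rewrite (ok_odd ok_uf) u_perm.
    rewrite inE => /andP[+ /imsetP[g _ Du]].
    by rewrite Du mem_Alt_tr negbK phi_perm => ->.
have /tildeR_rank rank_ab := greenR_tildeR Rab.
have orb (x y : tend 4) : greenR x y -> x \in Bn 4 :|: Cn 4 ->
    rank_class x = rank_class y -> AutT_orbit_eq x y.
  move=> /greenRP[_ [c ->]] BC_x rank_xy; apply: Aut_orbit.
  apply: (BC_mul_Aut BC_x); rewrite rank_E1 -rank_xy -rank_E1.
  exact: BC_notin_E1.
have [BC_a|not_BCa] := boolP (a \in Bn 4 :|: Cn 4).
  by right; constructor 3; apply: orb.
have [BC_b|not_BCb] := boolP (b \in Bn 4 :|: Cn 4).
  right; constructor 3; apply: orbit_sym; apply: orb => //.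
  by apply/greenRP; have /greenRP[] := Rab.
have [[g Da]|[g Da]|[t [e [ok_te Da]]]] := tend4_cases a.
- by right; constructor 1; rewrite !rank_Aut -rank_ab Da rank_psi.
- by right; constructor 2; rewrite !rank_D4 -rank_ab Da rank_sig.
have [[h Db]|[h Db]|[u [f [ok_uf Db]]]] := tend4_cases b.
- by right; constructor 1; rewrite !rank_Aut rank_ab Db rank_psi.
- by right; constructor 2; rewrite !rank_D4 rank_ab Db rank_sig.
left; move: rank_ab not_BCa not_BCb; rewrite Da Db !rank_phi // !mem_BC_phi //.
have := mem_phi ok_te; have := mem_phi ok_uf => mem_b mem_a.
case: ifP => [qa | nqa]; last case: ifP => ia.
- case: ifP => [qb | _]; last by case: ifP.
  by exists (E1 4); [rewrite !inE eqxx | rewrite mem_a mem_b qa].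
- case: ifP => // nqb; case: ifP => // ib _ /=; rewrite !negbK => sa sb.
  by exists (E2 4); [rewrite !inE eqxx !orbT | rewrite mem_a mem_b nqa nqb ia ib sa].
- case: ifP => // nqb; case: ifP => // ib _ /=; rewrite !negbK => sa sb.
  by exists (E3 4); [rewrite !inE eqxx !orbT | rewrite mem_a mem_b nqa nqb ia ib sa].
Qed.

Lemma sig_idem h : h \in Klein -> idem (sig h).
Proof. by move=> K_h; rewrite /idem sig_mul_sig p_perm_ker ?mul1g. Qed.

(** In [sig g] the element [g] is a product of an element that fixes 4 and one
    of the Klein group; the latter gives the idempotent right identity, and
    it is determined by the image of 4. *)
Lemma sig_right_identity g : exists h, [/\ idem (sig h), sig g * sig h = sig g
  & forall k, sig k * sig h = sig k -> k pt4 = g pt4].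
Proof.
have [k K_k Dp] := p_perm_Klein g; pose h := k^-1 ^ g.
have Dg : p_perm g * h = g by rewrite Dp -mulgA -conjgC mulKVg.
have h4 l : sig l * sig h = sig l -> l pt4 = h pt4.
  move/(congr1 (fun a : tend 4 => a (cst pt4))); rewrite tend_mulE.
  by rewrite !sig_sing ?cst_sing // => /cst_inj.
exists h; split=> [||l /h4 ->].
- by apply/sig_idem/KleinJ/KleinV.
- by rewrite sig_mul_sig Dg.
- by apply/esym/h4; rewrite sig_mul_sig Dg.
Qed.

(** A product of an element of B or C with an endomorphism that is not an
    automorphism lies in E1, so right identities are automorphisms. With
    [Aut_idem] this makes 1 the only idempotent right identity of these
    elements, which explains the large class of L~. *)
Lemma right_identity_Aut (a x : tend 4) : a \in AutT 4 :|: Bn 4 :|: Cn 4 ->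
  a * x = a -> x \in AutT 4.
Proof.
rewrite -setUA in_setU => /orP[Aut_a | BC_a] ax.
  by move: Aut_a; rewrite -ax AutT_mul => /andP[].
by apply: (BC_mul_Aut BC_a); rewrite ax BC_notin_E1.
Qed.

Lemma Aut_idem (x : tend 4) : x \in AutT 4 -> idem x -> x = 1.
Proof.
case/AutP=> g ->; rewrite /idem psiM => /(congr1 (fun a : tend 4 => psi g^-1 * a)).
by rewrite !psiM mulKg mulVg psi1 => <-.
Qed.

Lemma idem_or_ABC (a : tend 4) :
  [\/ a \in D4, a \in AutT 4 :|: Bn 4 :|: Cn 4 | idem a /\ (1 < rank_class a)%N].
Proof.
rewrite -setUA in_setU.
have [[g ->]|[g ->]|[t [e [ok_te ->]]]] := tend4_cases a.
- by constructor 2; rewrite mem_psi.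
- by constructor 1; rewrite mem_sig.
rewrite mem_BC_phi // mem_phi //=.
have [perm_or_e|] := boolP ((t \in Sym_tr 4) || (t == e)).
  constructor 3; split; first exact: phi_end_idem.
  by rewrite rank_phi //; case: ifP => // _; case: ifP.
by rewrite negb_or => /andP[s q]; constructor 2; rewrite s q orbT.
Qed.

(** An endomorphism outside D(4), B, C and the automorphism group is idempotent,
    hence a right identity of itself, and L~ between idempotents is L. *)
Lemma tildeL_tend4 (a b : tend 4) : tildeL a b <->
  [\/ a = b,
      (a \in AutT 4 :|: Bn 4 :|: Cn 4) && (b \in AutT 4 :|: Bn 4 :|: Cn 4)
    | sigma_agree a b].
Proof.
split=> [Lab | [-> // | /andP[ABC_a ABC_b] x idem_x | agree_ab]]; last first.
- exact/starL_tildeL/greenL_starL/agree_greenL.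
- have one (c d : tend 4) : c \in AutT 4 :|: Bn 4 :|: Cn 4 -> c * x = c -> d * x = d.
    by move=> /right_identity_Aut/[apply]/Aut_idem-> //; rewrite mulg1.
  by split; apply: one.
have not_D_ABC (c d : tend 4) : tildeL c d -> c \in D4 ->
    d \in AutT 4 :|: Bn 4 :|: Cn 4 -> False.
  move=> Lcd /D4P[g Dc] ABC_d; have [h [idem_h gh _]] := sig_right_identity g.
  have /(right_identity_Aut ABC_d) : d * sig h = d by apply/Lcd; rewrite ?Dc.
  by rewrite mem_sig.
have not_idem_ABC (c d : tend 4) : tildeL c d -> idem c -> (1 < rank_class c)%N ->
    d \in AutT 4 :|: Bn 4 :|: Cn 4 -> False.
  move=> Lcd idem_c rank_c ABC_d.
  have /(right_identity_Aut ABC_d) : d * c = d by apply/Lcd.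
  by rewrite rank_Aut => /eqP Ec; rewrite Ec in rank_c.
have not_idem_D (c d : tend 4) : tildeL c d -> idem c -> (1 < rank_class c)%N ->
    d \in D4 -> False.
  move=> Lcd idem_c rank_c; rewrite rank_D4 => /eqP rank_d.
  have dc : d * c = d by apply/Lcd.
  by have := rank_mull d c; rewrite dc rank_d leqNgt rank_c.
have Lba := tildeL_sym Lab.
have [Da|ABC_a|[idem_a rank_a]] := idem_or_ABC a;
  have [Db|ABC_b|[idem_b rank_b]] := idem_or_ABC b.
- constructor 3; case/D4P: Da Db Lab {Lba} => g -> /D4P[h ->] Lab.
  have [k [idem_k gk eq4]] := sig_right_identity g.
  by apply: sigma_agreeP; apply/esym/eq4/Lab.
- by case: (not_D_ABC _ _ Lab).
- by case: (not_idem_D _ _ Lba).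
- by case: (not_D_ABC _ _ Lba).
- by constructor 2; rewrite ABC_a.
- by case: (not_idem_ABC _ _ Lba).
- by case: (not_idem_D _ _ Lab).
- by case: (not_idem_ABC _ _ Lab).
(* both [a] and [b] are idempotent, hence right identities of each other *)
have ba : b * a = b by apply/Lab.
have ab : a * b = a by apply/Lba.
have /greenL_tend4[-> | /andP[] | [g [h [Da _ _]]]] : greenL a b.
- by apply/greenLP; split; [exists a | exists b].
- by constructor 1.
- by rewrite rank_Aut => /eqP Ea; rewrite Ea in rank_a.
suff : a \in D4 by rewrite rank_D4 => /eqP Ea; rewrite Ea in rank_a.
by apply/D4P; exists g; apply: val_inj; rewrite /= Da sig_fun.
Qed.

Lemma Fix_phi t e g : phi_ok t e ->
  (g \in Fix_pair t e) = (phi_end t e * psi g == phi_end t e).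
Proof.
move=> ok_te; have [ok_g ->] := phi_end_mul (psi g) ok_te; rewrite inE -!psiE.
by apply/andP/eqP=> [[/eqP-> /eqP->] // | /phi_end_inj[] // -> ->].
Qed.

(** Two right multipliers are identified by [phi_end t e] either because neither
    is an automorphism, and then only their common value on the singular maps
    counts, or because they are automorphisms that differ by the stabiliser of
    the pair. Only the second case depends on the pair, through the
    stabiliser; this is why L* on B and C is described by [Fix_pair]. *)
Lemma BC_cancel t e (c d : tend 4) : phi_ok t e -> phi_end t e \in Bn 4 :|: Cn 4 ->
  phi_end t e * c = phi_end t e * d <->
  [/\ c \notin AutT 4, d \notin AutT 4 & c (cst pt4) = d (cst pt4)] \/
  exists g h, [/\ c = psi g, d = psi h & g * h^-1 \in Fix_pair t e].
Proof.
move=> ok_te BC_a; set a := phi_end t e.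
have to_Aut x y : a * x = a * y -> x \in AutT 4 -> y \in AutT 4.
  case/BC_phi: (BC_a) => u [f [_ _ _ _]] eq_xy Aut_x.
  apply: (BC_mul_Aut BC_a); rewrite -/a -eq_xy rank_E1.
  have /AutP[g ->] := Aut_x; have -> : rank_class (a * psi g) = rank_class a.
    apply/eqP; rewrite eqn_leq rank_mulr andbT.
    rewrite -[a in (_ <= rank_class a)%N]mulg1 -psi1 -(mulgV g) -psiM mulgA.
    exact: rank_mulr.
  by rewrite -rank_E1 BC_notin_E1.
split=> [eq_cd | [[nonAut_c nonAut_d eq_cd] | [g [h [-> -> gh]]]]]; last 2 first.
- by rewrite !BC_mul_nonAut // eq_cd.
- move: gh; rewrite Fix_phi // -/a => /eqP gh.
  by rewrite -{2}gh -mulgA psiM mulgKV.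
have [Aut_c|nonAut_c] := boolP (c \in AutT 4).
  right; have /AutP[h Dd] := to_Aut c d eq_cd Aut_c; case/AutP: Aut_c => g Dc.
  exists g, h; split=> //; rewrite Fix_phi // -psiM mulgA -/a -Dc eq_cd Dd.
  by rewrite -mulgA psiM mulgV psi1 mulg1.
have nonAut_d : d \notin AutT 4 by apply: contra nonAut_c; apply: to_Aut.
left; split=> //; move: eq_cd; rewrite !BC_mul_nonAut //.
by case/phi_end_inj => //; rewrite /phi_ok -!tendM !mul_cst eqxx.
Qed.

Lemma BC_agreeP t e (u f : trans 4) : phi_ok t e -> phi_ok u f ->
  phi_end t e \in Bn 4 :|: Cn 4 -> phi_end u f \in Bn 4 :|: Cn 4 ->
  Fix_pair t e = Fix_pair u f -> BC_fix_agree (phi_end t e) (phi_end u f).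
Proof. by move=> ok_te ok_uf; exists t, e, u, f; rewrite !phi_endE. Qed.

Lemma starL_tend4 (a b : tend 4) : starL a b <->
  [\/ (a \in AutT 4) && (b \in AutT 4),
      [/\ (a * a)%g = a, a = b & b = (b * b)%g],
      sigma_agree a b
    | BC_fix_agree a b].
Proof.
split=> [Lab | [/andP[Aut_a Aut_b] | [_ -> _] // | agree_ab | ]]; last first.
- case=> t [e [u [f [Da Db BC_a BC_b eq_Fix]]]] c d.
  case/BC_phi: (BC_a) => t' [e' [ok_te Da' _ _]]; move: Da; rewrite Da' phi_endE //.
  case/phi_inj=> Et Ee; subst t' e'.
  case/BC_phi: (BC_b) => u' [f' [ok_uf Db' _ _]]; move: Db; rewrite Db' phi_endE //.
  case/phi_inj=> Eu Ef; subst u' f'; rewrite Da' in BC_a; rewrite Db' in BC_b.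
  have := BC_cancel c d ok_te BC_a; rewrite eq_Fix => cancel_a.
  exact: iff_trans cancel_a (iff_sym (BC_cancel c d ok_uf BC_b)).
- exact/greenL_starL/agree_greenL.
- by apply/greenL_starL/greenL_tend4; constructor 2; rewrite Aut_a.
have refl_sig (c : tend 4) : c \in D4 -> sigma_agree c c.
  by case/D4P=> g ->; apply: sigma_agreeP.
have not_Aut_BC (c d : tend 4) : starL c d -> c \in AutT 4 ->
    d \in Bn 4 :|: Cn 4 -> False.
  move=> Lcd /AutP[g Dc] BC_d.
  have ok1 := one_cst4_ok; have ok2 := cst4_ok.
  have /Lcd : d * phi_end 1 (cst pt4) = d * phi_end (cst pt4) (cst pt4).
    rewrite !BC_mul_nonAut ?mem_phi //.
    by rewrite !phi_endE // !phi_sing ?cst_sing.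
  rewrite Dc !psi_mul_phi // => /phi_end_inj[] // E1 _.
  by have := cst_sing pt4; rewrite -E1 -trans_of_perm1 mem_Sym_tr.
have /tildeL_tend4[Eab | /andP[] | agree_ab] := starL_tildeL Lab; last by constructor 3.
- have [D_a|ABC_a|[idem_a _]] := idem_or_ABC a.
  + by constructor 3; rewrite -Eab; apply: refl_sig.
  + move: ABC_a; rewrite -setUA in_setU => /orP[Aut_a|BC_a].
      by constructor 1; rewrite -Eab Aut_a.
    constructor 4; rewrite -Eab; case/BC_phi: (BC_a) => t [e [ok_te Da _ _]].
    by rewrite Da in BC_a *; apply: BC_agreeP.
  by constructor 2; rewrite -Eab; split; rewrite ?idem_a.
rewrite -!setUA !(in_setU _ (AutT 4)) => /orP[Aut_a|BC_a] /orP[Aut_b|BC_b].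
- by constructor 1; rewrite Aut_a.
- by case: (not_Aut_BC _ _ Lab).
- by case: (not_Aut_BC _ _ (starL_sym Lab)).
constructor 4; case/BC_phi: (BC_a) => t [e [ok_te Da _ _]].
case/BC_phi: (BC_b) => u [f [ok_uf Db _ _]].
rewrite Da Db in BC_a BC_b Lab *; apply: BC_agreeP => //.
apply/setP=> g; rewrite !Fix_phi //; have := Lab (psi g) 1; rewrite !mulg1.
by move=> Lg; apply/eqP/eqP=> /Lg.
Qed.

(** * Joins and principal ideals *)

Lemma classes_are_fibers (T : finType) (r : T -> T -> Prop) (F : T -> nat)
    (P : {set {set T}}) :
  (forall a b, r a b <-> F a = F b) ->
  (forall X, X \in P -> exists a, forall b, (b \in X) = (F b == F a)) ->
  (forall a, exists2 X, X \in P & a \in X) -> classes_are r P.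
Proof.
move=> rF P_fiber coverP X; split=> [/P_fiber[a Xa] | [a Xa]].
  by exists a => b; rewrite Xa eq_sym; split=> [/eqP/rF | /rF/eqP].
have [Y PY Ya] := coverP a; suff -> : X = Y by [].
have [c Yc] := P_fiber Y PY; move: Ya; rewrite Yc => /eqP Fa.
by apply/setP=> b; rewrite Yc -Fa eq_sym; apply/idP/eqP=> [/Xa/rF | /rF/Xa].
Qed.

Lemma rank_middle (a : tend 4) :
  (a \in E3 4 :|: Bn 4 :|: E2 4 :|: Cn 4) = (1 < rank_class a < 4)%N.
Proof.
rewrite !in_setU; have [[g ->]|[g ->]|[t [e [ok_te ->]]]] := tend4_cases a.
- by rewrite !mem_psi rank_psi.
- by rewrite !mem_sig rank_sig.
rewrite !mem_phi // rank_phi //.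
by case: (t == e); case: (t == _); case: (t \in Sym_tr 4).
Qed.

(** The elements whose number is at least that of [a] form a saturated ideal. *)
Lemma saturated_ideal_class (r1 r2 : tend 4 -> tend 4 -> Prop) (F : tend 4 -> nat) :
  (forall c a, F a <= F (c * a) /\ F a <= F (a * c)) ->
  (forall a b, r1 a b -> F a = F b) -> (forall a b, r2 a b -> F a = F b) ->
  forall a b, (forall x, sat_ideal r1 r2 a x <-> sat_ideal r1 r2 b x) -> F a = F b.
Proof.
move=> F_mul F1 F2.
suff le_ab a b : (forall x, sat_ideal r1 r2 a x <-> sat_ideal r1 r2 b x) -> F a <= F b.
  by move=> a b Jab; apply/eqP; rewrite eqn_leq !le_ab // => x; apply: iff_sym.
move=> Jab; have /Jab : sat_ideal r1 r2 b b by [].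
move/(_ (fun x => F a <= F x)); apply=> //.
- by move=> x c le_ax; have [le1 le2] := F_mul c x; split; apply: leq_trans le_ax _.
- by move=> x y /F1->.
- by move=> x y /F2->.
Qed.

Lemma join_sat_ideal (M : monoidType) (r1 r2 : M -> M -> Prop) :
  (forall a b, r1 a b -> r1 b a) -> (forall a b, r2 a b -> r2 b a) ->
  forall a b, rel_join r1 r2 a b ->
  forall x, sat_ideal r1 r2 a x <-> sat_ideal r1 r2 b x.
Proof.
move=> sym1 sym2 a b r_ab x.
split=> Jx I idI sat1 sat2 I_c; apply: Jx => //.
  by have [_] := join_saturated sym1 sym2 sat1 sat2 r_ab; apply.
by have [+ _] := join_saturated sym1 sym2 sat1 sat2 r_ab; apply.
Qed.

(** The maps below serve to link the R*-classes of B and C: the pairs formed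
    with the constant map at 4 have the same stabiliser, the group generated by
    (1 2), since this transposition commutes with the swap of 1 and 2. *)
Definition swap_collapse : trans 4 := tr4 pt2 pt1 pt4 pt4.
Definition collapse : trans 4 := tr4 pt1 pt2 pt4 pt4.

Definition linkB : tend 4 := phi_end swap_collapse (cst pt4).
Definition linkC : tend 4 := phi_end collapse (cst pt4).

Lemma swap_collapse_ok : phi_ok swap_collapse (cst pt4).
Proof. by rewrite /phi_ok !mul_cst !cst_mul !(tr4M, tr4E) !eqxx. Qed.

Lemma swap_collapse_sq : swap_collapse * swap_collapse = collapse.
Proof. by rewrite /swap_collapse !(tr4M, tr4E). Qed.

Lemma collapse_ok : phi_ok collapse (cst pt4).
Proof. by rewrite -swap_collapse_sq; apply/ok_sq/swap_collapse_ok. Qed.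

Lemma collapse_facts :
  [/\ swap_collapse != cst pt4, collapse != cst pt4,
      swap_collapse != collapse, swap_collapse \notin Sym_tr 4
    & collapse \notin Sym_tr 4].
Proof.
have neq (u v : trans 4) : u pt1 != v pt1 -> u != v by apply: contra => /eqP->.
have sing (u : trans 4) : u pt3 = u pt4 -> u \notin Sym_tr 4.
  by move=> eq34; apply/Sym_trP=> /(_ _ _ eq34).
by split; rewrite ?sing ?neq // ?cstE !tr4E.
Qed.

Lemma rank_linkB : rank_class linkB = 2.
Proof.
have [neB _ neq _ _] := collapse_facts.
by rewrite (rank_phi swap_collapse_ok) (negPf neB) swap_collapse_sq (negPf neq).
Qed.

Lemma rank_linkC : rank_class linkC = 3.
Proof.
have [_ neC _ _ _] := collapse_facts.
rewrite (rank_phi collapse_ok) (negPf neC) -swap_collapse_sq !mulgA.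
by rewrite (ok_ttt swap_collapse_ok) eqxx.
Qed.

Lemma linkB_BC : linkB \in Bn 4 :|: Cn 4.
Proof.
by have [neB _ _ sB _] := collapse_facts; rewrite (mem_BC_phi swap_collapse_ok) neB.
Qed.

Lemma linkC_BC : linkC \in Bn 4 :|: Cn 4.
Proof.
by have [_ neC _ _ sC] := collapse_facts; rewrite (mem_BC_phi collapse_ok) neC.
Qed.

Lemma link_Fix : Fix_pair swap_collapse (cst pt4) = Fix_pair collapse (cst pt4).
Proof.
apply/setP=> g; rewrite !inE; apply/andP/andP=> [] [/eqP fix_t fix_e]; split=> //.
  by rewrite -swap_collapse_sq tconjM fix_t.
have g4 : g pt4 = pt4 by move: fix_e; rewrite tconj_cst => /eqP/cst_inj.
have /tconjP fix_c : collapse == tconj collapse g by rewrite fix_t.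
have injg := @perm_inj _ g.
have g3 : g pt3 = pt3.
  have := fix_c pt3; rewrite tr4E g4.
  have: g pt3 != g pt4 by rewrite (inj_eq injg).
  by rewrite g4; case: (ord4P (g pt3)) => ->; rewrite /collapse ?tr4E.
rewrite eq_sym; apply/tconjP.
have: g pt1 != g pt3 by rewrite (inj_eq injg).
have: g pt1 != g pt4 by rewrite (inj_eq injg).
have: g pt2 != g pt3 by rewrite (inj_eq injg).
have: g pt2 != g pt4 by rewrite (inj_eq injg).
have: g pt1 != g pt2 by rewrite (inj_eq injg).
rewrite g3 g4 => + + + + + i.
case: (ord4P (g pt1)) (ord4P (g pt2)) => [] g1 [] g2; rewrite g1 g2 //= => _ _ _ _ _;
  by case: (ord4P i) => ->; rewrite !tr4E ?g1 ?g2 ?g3 ?g4 !tr4E.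
Qed.

Lemma link_starL : starL linkB linkC.
Proof.
apply/starL_tend4; constructor 4; apply: BC_agreeP link_Fix.
- exact: swap_collapse_ok.
- exact: collapse_ok.
- exact: linkB_BC.
- exact: linkC_BC.
Qed.

(** The numbering of the R*-classes after the links by L* inside
    [Bn 4 :|: Cn 4]: the numbers 2 and 3 are merged. *)
Definition star_class (a : tend 4) : nat := nth 0 [:: 0; 1%N; 2; 2; 3] (rank_class a).

(** The relation L~ moreover joins the automorphisms to B and C. *)
Definition tilde_class (a : tend 4) : nat := nth 0 [:: 0; 1%N; 0; 0; 2] (rank_class a).

Lemma agree_rank (a b : tend 4) :
  sigma_agree a b -> rank_class a = 1%N /\ rank_class b = 1%N.
Proof.
have sig_rank (c : tend 4) g : tend_fun c = sigma_conj g -> rank_class c = 1%N.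
  move=> Dc; rewrite (_ : c = sig g) ?rank_sig //.
  by apply: val_inj; rewrite /= Dc sig_fun.
by move=> [g [h [/sig_rank-> /sig_rank-> _]]].
Qed.

Lemma BC_rank (a : tend 4) : a \in Bn 4 :|: Cn 4 -> (1 < rank_class a < 4)%N.
Proof. by rewrite -rank_middle !in_setU => /orP[]->; rewrite !orbT. Qed.

Lemma starL_class (a b : tend 4) : starL a b -> star_class a = star_class b.
Proof.
rewrite /star_class; case/starL_tend4=> [|[_ ->] // |/agree_rank[-> ->] // |].
  by rewrite !rank_Aut => /andP[/eqP-> /eqP->].
case=> t [e [u [f [_ _ /BC_rank rk_a /BC_rank rk_b _]]]]; move: rk_a rk_b.
by case: (rank_class a) (rank_class b) => [|[|[|[|]]]] // [|[|[|[|]]]].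
Qed.

Lemma starR_class (a b : tend 4) : starR a b -> star_class a = star_class b.
Proof. by move/starR_rankE; rewrite /star_class => ->. Qed.

Lemma starD_class (a b : tend 4) : starD a b <-> star_class a = star_class b.
Proof.
split=> [|eq_class]; first exact: join_invariant starL_class starR_class _ _.
have starR_D (c d : tend 4) : rank_class c = rank_class d -> starD c d.
  by move/starR_rank; apply: join2.
have link (c d : tend 4) : rank_class c = 2 -> rank_class d = 3 -> starD c d.
  move=> rk_c rk_d; apply: (@rst_trans _ _ _ linkB).
    by apply: starR_D; rewrite rank_linkB.
  apply: (@rst_trans _ _ _ linkC); first exact: join1 link_starL.
  by apply: starR_D; rewrite rank_linkC.
move: eq_class (rank_le4 a) (rank_le4 b); rewrite /star_class.
case Ea: (rank_class a) => [|[|[|[|[|]]]]] //;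
  case Eb: (rank_class b) => [|[|[|[|[|]]]]] //= _ _ _;
  try by [apply: starR_D; rewrite Ea Eb | apply: link].
by apply: rst_sym; apply: link.
Qed.

Lemma starD_starJ (a b : tend 4) : starD a b <-> starJ a b.
Proof.
split=> [|Jab]; first exact: join_sat_ideal (@starL_sym _) (@starR_sym _) _ _.
apply/starD_class; apply: saturated_ideal_class starL_class starR_class _ _ Jab.
have mono (m n : nat) : m <= n -> n <= 4 ->
    nth 0 [:: 0; 1%N; 2; 2; 3] m <= nth 0 [:: 0; 1%N; 2; 2; 3] n.
  by case: n m => [|[|[|[|[|]]]]] // [|[|[|[|[|]]]]].
by move=> c d; split; apply: mono; rewrite ?rank_mull ?rank_mulr ?rank_le4.
Qed.

Lemma tildeL_class (a b : tend 4) : tildeL a b -> tilde_class a = tilde_class b.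
Proof.
rewrite /tilde_class; case/tildeL_tend4=> [->|/andP[]|/agree_rank[-> ->]] //.
have ABC_class (c : tend 4) : c \in AutT 4 :|: Bn 4 :|: Cn 4 ->
    nth 0 [:: 0; 1%N; 0; 0; 2] (rank_class c) = 0.
  rewrite -setUA in_setU => /orP[|/BC_rank]; first by rewrite rank_Aut => /eqP->.
  by case: (rank_class c) => [|[|[|[|]]]].
by move=> /ABC_class-> /ABC_class->.
Qed.

Lemma tildeR_class (a b : tend 4) : tildeR a b -> tilde_class a = tilde_class b.
Proof. by move/tildeR_rank; rewrite /tilde_class => ->. Qed.

Lemma tildeD_class (a b : tend 4) : tildeD a b <-> tilde_class a = tilde_class b.
Proof.
split=> [|eq_class]; first exact: join_invariant tildeL_class tildeR_class _ _.
have tildeR_D (c d : tend 4) : rank_class c = rank_class d -> tildeD c d.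
  by move/tildeR_rank; apply: join2.
have toBC (c : tend 4) : c \in Bn 4 :|: Cn 4 -> tildeD c 1.
  move=> BC_c; apply/join1/tildeL_tend4; constructor 2.
  by rewrite -setUA !(in_setU _ (AutT 4)) BC_c orbT -psi1 psi_Aut.
have to1 (c : tend 4) : tilde_class c = 0 -> tildeD c 1.
  move: (rank_le4 c); rewrite /tilde_class.
  case Ec: (rank_class c) => [|[|[|[|[|]]]]] // _ _.
  - by apply: tildeR_D; rewrite Ec -psi1 rank_psi.
  - apply: rst_trans (toBC _ linkB_BC).
    by apply: tildeR_D; rewrite Ec rank_linkB.
  - apply: rst_trans (toBC _ linkC_BC).
    by apply: tildeR_D; rewrite Ec rank_linkC.
have [Ea|Ea] := eqVneq (tilde_class a) 0.
  by apply: rst_trans (to1 a Ea) (rst_sym _ _ _ _ (to1 b _)); rewrite -eq_class.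
apply: tildeR_D; move: eq_class Ea (rank_le4 a) (rank_le4 b); rewrite /tilde_class.
by case: (rank_class a) (rank_class b) => [|[|[|[|[|]]]]] // [|[|[|[|[|]]]]].
Qed.

Definition is_E1 (a : tend 4) : nat := (rank_class a == 4).

Lemma is_E1_tilde (a b : tend 4) : tilde_class a = tilde_class b -> is_E1 a = is_E1 b.
Proof.
rewrite /tilde_class /is_E1; move: (rank_le4 a) (rank_le4 b).
by case: (rank_class a) (rank_class b) => [|[|[|[|[|]]]]] // [|[|[|[|[|]]]]].
Qed.

(** A saturated ideal that meets the complement of E1 contains 1, hence
    everything. Outside D(4) the complement of E1 is the D~-class of 1; an
    element of D(4) is a left identity of an element of B, which therefore
    lies in the ideal. *)
Lemma tildeJ_class (a b : tend 4) : tildeJ a b <-> is_E1 a = is_E1 b.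
Proof.
split=> [|eq_E1].
  apply: saturated_ideal_class.
  - move=> c d.
    have le_E1 (x y : tend 4) : rank_class x <= rank_class y -> is_E1 x <= is_E1 y.
      move: (rank_le4 y); rewrite /is_E1; case: eqP => // ->.
      by case: eqP => // neq4 le4 ge4; case: neq4; apply/eqP; rewrite eqn_leq le4.
    by split; apply: le_E1; rewrite ?rank_mull ?rank_mulr.
  - by move=> c d /tildeL_class/is_E1_tilde.
  - by move=> c d /tildeR_class/is_E1_tilde.
have D_J (c d : tend 4) : tildeD c d -> tildeJ c d.
  exact: join_sat_ideal (@tildeL_sym _) (@tildeR_sym _) _ _.
have [Ea|Ea] := eqVneq (is_E1 a) 1%N.
  apply/D_J/tildeD_class; move: eq_E1 Ea; rewrite /tilde_class /is_E1.
  by case: eqP => // ->; case: eqP => // ->.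
have all_in (c x : tend 4) : is_E1 c != 1%N -> sat_ideal (@tildeL _) (@tildeR _) c x.
  move=> Ec I idI sat1 sat2 I_c; suff I1 : I 1.
    by rewrite -[x]mul1g; have [] := idI 1 x I1.
  have D_I (y z : tend 4) : tildeD y z -> I y -> I z.
    by move/(join_saturated (@tildeL_sym _) (@tildeR_sym _) sat1 sat2)=> -[].
  have class1 : tilde_class 1 = 0 by rewrite /tilde_class -psi1 rank_psi.
  have [Dc|/eqP notDc] := rank_class c =P 1%N.
    have I_link : I linkB.
      have /D4P[g Dg] : c \in D4 by rewrite rank_D4 Dc.
      rewrite /linkB -(sig_mul_phi g swap_collapse_ok) -Dg.
      by have [] := idI c linkB I_c.
    by apply: D_I I_link; apply/tildeD_class; rewrite class1 /tilde_class rank_linkB.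
  apply: D_I I_c; apply/tildeD_class; rewrite class1 /tilde_class.
  move: notDc Ec (rank_le4 c); rewrite /is_E1.
  by case: (rank_class c) => [|[|[|[|[|]]]]].
by move=> x; split=> _; apply: all_in; rewrite -?eq_E1.
Qed.


Definition zero_end : tend 4 := phi_end (cst pt4) (cst pt4).

Lemma rank_representatives :
  [/\ rank_class 1 = 0, rank_class (sig 1) = 1%N & rank_class zero_end = 4].
Proof.
by split; [rewrite -psi1 rank_psi | rewrite rank_sig | rewrite (rank_phi cst4_ok) eqxx].
Qed.

Lemma starD_classes : classes_are (@starD (tend 4))
  [set AutT 4; D4; E3 4 :|: Bn 4 :|: E2 4 :|: Cn 4; E1 4].
Proof.
have [rk1 rk_sig rk_zero] := rank_representatives.
apply: classes_are_fibers starD_class _ _ => [X | a].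
  rewrite !in_setU !in_set1 -!orbA => /or4P[]/eqP->;
    [exists 1 | exists (sig 1) | exists linkB | exists zero_end] => b;
    rewrite ?rank_Aut ?rank_D4 ?rank_middle ?rank_E1 /star_class
            ?rk1 ?rk_sig ?rank_linkB ?rk_zero;
    by move: (rank_le4 b); case: (rank_class b) => [|[|[|[|[|]]]]].
have [Ea|Ea|Ea|Ea] : [\/ a \in AutT 4, a \in D4,
    a \in E3 4 :|: Bn 4 :|: E2 4 :|: Cn 4 | a \in E1 4].
- rewrite rank_Aut rank_D4 rank_middle rank_E1; move: (rank_le4 a).
  by case: (rank_class a) => [|[|[|[|[|]]]]] // _;
    [constructor 1 | constructor 2 | constructor 3 | constructor 3 | constructor 4].
- by exists (AutT 4); rewrite // !in_setU !in_set1 eqxx.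
- by exists D4; rewrite // !in_setU !in_set1 eqxx ?orbT.
- by exists (E3 4 :|: Bn 4 :|: E2 4 :|: Cn 4); rewrite // !in_setU !in_set1 eqxx ?orbT.
- by exists (E1 4); rewrite // !in_setU !in_set1 eqxx ?orbT.
Qed.

Lemma tildeD_classes :
  classes_are (@tildeD (tend 4)) [set D4; E1 4; ~: (D4 :|: E1 4)].
Proof.
have [rk1 rk_sig rk_zero] := rank_representatives.
apply: classes_are_fibers tildeD_class _ _ => [X | a].
  rewrite !in_setU !in_set1 -!orbA => /or3P[]/eqP->;
    [exists (sig 1) | exists zero_end | exists 1] => b;
    rewrite ?in_setC ?in_setU ?rank_D4 ?rank_E1 /tilde_class ?rk1 ?rk_sig ?rk_zero;
    by move: (rank_le4 b); case: (rank_class b) => [|[|[|[|[|]]]]].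
have [D_a|notD_a] := boolP (a \in D4).
  by exists D4; rewrite // !in_setU !in_set1 eqxx.
have [E_a|notE_a] := boolP (a \in E1 4).
  by exists (E1 4); rewrite // !in_setU !in_set1 eqxx ?orbT.
exists (~: (D4 :|: E1 4)); first by rewrite !in_setU !in_set1 eqxx ?orbT.
by rewrite in_setC in_setU negb_or notD_a notE_a.
Qed.

Lemma tildeJ_classes : classes_are (@tildeJ (tend 4)) [set ~: E1 4; E1 4].
Proof.
have [rk1 _ rk_zero] := rank_representatives.
apply: classes_are_fibers tildeJ_class _ _ => [X | a].
  rewrite !in_setU !in_set1 => /orP[]/eqP->; [exists 1 | exists zero_end] => b;
    rewrite ?in_setC rank_E1 /is_E1 ?rk1 ?rk_zero;
    by case: (_ == 4).
have [E_a|notE_a] := boolP (a \in E1 4).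
  by exists (E1 4); rewrite // !in_setU !in_set1 eqxx ?orbT.
by exists (~: E1 4); rewrite ?in_setC // !in_setU !in_set1 eqxx.
Qed.

Theorem proposition7p3 :
  (forall a b : tend 4, greenL a b <->
     [\/ a = b, (a \in AutT 4) && (b \in AutT 4) | sigma_agree a b]) /\
  (forall a b : tend 4, greenR a b <->
     (exists2 X : {set tend 4}, X \in [:: E1 4; E2 4; E3 4]
                              & (a \in X) && (b \in X)) \/
     [\/ (a \in AutT 4) && (b \in AutT 4), (a \in D4) && (b \in D4)
       | AutT_orbit_eq a b]) /\
  (forall a b : tend 4, tildeL a b <->
     [\/ a = b,
         (a \in AutT 4 :|: Bn 4 :|: Cn 4) && (b \in AutT 4 :|: Bn 4 :|: Cn 4)
       | sigma_agree a b]) /\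
  (forall a b : tend 4, starL a b <->
     [\/ (a \in AutT 4) && (b \in AutT 4),
         [/\ (a * a)%g = a, a = b & b = (b * b)%g],
         sigma_agree a b
       | BC_fix_agree a b]) /\
  ((forall a b : tend 4, starD a b <-> starJ a b) /\
   classes_are (@starD (tend 4))
     [set AutT 4; D4; E3 4 :|: Bn 4 :|: E2 4 :|: Cn 4; E1 4]) /\
  classes_are (@tildeD (tend 4)) [set D4; E1 4; ~: (D4 :|: E1 4)] /\
  classes_are (@tildeJ (tend 4)) [set ~: E1 4; E1 4].

Proof.
split; first exact: greenL_tend4.
split; first exact: greenR_tend4.
split; first exact: tildeL_tend4.
split; first exact: starL_tend4.
split; first by split; [exact: starD_starJ | exact: starD_classes].
split; [exact: tildeD_classes | exact: tildeJ_classes].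
Qed.
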